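(* (i) If $S_n(A)$ is dictionaric and $p\in S_n(A)$ is a pre-minimal type, then there is an $A$-definable approximately minimal pair $(D,P)$ pointing to $p$. (ii) If $D\subseteq S_n(A)$ is approximately minimal over a model $\mathfrak M$, then there is a $(D(\mathfrak M)\cup A)$-definable minimal set $E\subseteq D$ pointing to the same type. (iii) If $D\subseteq S_n(A)$ is approximately strongly minimal (as part of the pair $(D,P)$), then for any model $\mathfrak M\supseteq A$, there is a $(D(\mathfrak M)\cup A)$-definable strongly minimal set $E\subseteq D$ pointing to the same type. Furthermore, for any model $\mathfrak N\succ\mathfrak M$, $E(\mathfrak N)\setminus\{a\in\mathfrak N: P(a)=0\}\subseteq D(\mathfrak M)$.
   Context: Setting: continuous first-order logic for metric structures. $S_n(A)$ is the space of complete $n$-types over a parameter set $A$, a compact Hausdorff space under the logic topology, also equipped with the metric $d(p,q)=\inf\{d(\bar a,\bar b):\bar a\models p,\ \bar b\models q\}$ computed in a monster model $\mathfrak C$. A formula over $A$ is a continuous function $S_n(A)\to\mathbb R$. For $Q\subseteq S_n(A)$, $Q^{<\varepsilon}=\{q:d(q,Q)<\varepsilon\}$. For $Q\subseteq F\subseteq S_n(A)$ closed, $Q$ is definable relative to $F$ if for every $\varepsilon>0$ there is an open-in-$F$ set $U$ with $Q\subseteq U\subseteq Q^{<\varepsilon}$; $Q$ is definable if it is definable relative to $S_n(A)$. A type $p\in F$ is $d$-atomic in $F$ if $\{p\}$ is definable relative to $F$. An $A$-zeroset is a set $\{\varphi=0\}$ for a formula $\varphi$ over $A$. For $X\subseteq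 S_n(A)$ and a model $\mathfrak M\supseteq A$, $X(\mathfrak M)$ is the set of tuples of $\mathfrak M$ whose type lies in $X$. A zeroset or type over $A$ is algebraic if its set of realizations in every model $\mathfrak M\supseteq A$ is metrically compact. $S_n(A)$ is dictionaric if for every $p\in S_n(A)$ and closed $F\not\ni p$ there is a definable $D$ with $p\in\operatorname{int}D$ and $D\cap F=\varnothing$. A non-algebraic definable set $D$ is minimal over $A$ if for each pair $F,G\subseteq D$ of disjoint $A$-zerosets, at most one of $F,G$ is non-algebraic; it is strongly minimal if it is minimal over every set of parameters (over which it is definable). A type $p\in S_n(A)$ is $(<\varepsilon)$-algebraic if for any model $\mathfrak M\supseteq A$ and any $q\in S_n(\mathfrak M)$ extending $p$, $d(q,\mathfrak M)<\varepsilon$, where $\mathfrak M$ is identified with the set of types realized by tuples of $\mathfrak M$ in $S_n(\mathfrak M)$. A set of types is $(<\varepsilon)$-algebraic if every type in it is. A type $p\in S_n(A)$ is pre-minimal (over $A$) if for all sufficiently small $\varepsilon>0$, $p$ is $d$-atomic in the (closed) set of non-$(<\varepsilon)$-algebraic types in $S_n(A)$. A pair $(D,\varphi)$ of a definable set $D\subseteq S_n(A)$ and an $A$-formula $\varphi$ is approximately minimal (over $A$) if the zeroset $\{\varphi=0\}\subseteq D$ is non-algebraic and for every pair $F,G\subseteq D$ of disjoint $A$-zerosets, every model $\mathfrak M\supseteq A$, and every $\varepsilon>0$, at least one of $F\cap\{\varphi\le\varepsilon\}$ and $G\cap\{\varphi\le\varepsilon\}$ is $(<\varepsilon)$-algebraic.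 It is approximately strongly minimal if it is approximately minimal over every set of parameters over which it is definable. A definable set $D$ is approximately (strongly) minimal if $(D,\varphi)$ is for some formula $\varphi$. An approximately minimal pair $(D,\varphi)$ over $A$ has a unique non-algebraic $A$-type in $\{\varphi=0\}$, its generic type; a minimal set over $A$ has a unique non-algebraic $A$-type. A pair or set ''points to'' a type if that type is its generic (unique non-algebraic, respectively) type.
   Formalization: In (ii), A ⊆ M and D is part of a pair (D,P) with D definable over A and P a formula over A, the pair being approximately minimal over M; if P may use arbitrary parameters from M, the claim fails. *)

(* Defs.v *)
From HB Require Import structures.
From mathcomp Require Import all_boot all_order all_algebra.
From mathcomp Require Import all_classical all_reals all_analysis.

Set Implicit Arguments.
Unset Strict Implicit.
Unset Printing Implicit Defensive.

Import Order.TTheory GRing.Theory Num.Theory.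
Import numFieldNormedType.Exports.

Local Open Scope classical_set_scope.
Local Open Scope card_scope.
Local Open Scope ring_scope.

Record language := Language {
  fsym : Type;
  far : fsym -> nat;
  psym : Type;
  par : psym -> nat
}.

(* Moduli of uniform continuity, bounds of predicates and the bound on the
   diameter are required to exist in the structure instead of being recorded in
   the language.  All the structures below are elementary substructures of a
   single one, which determines a choice of them. *)
Record structure (R : realType) (L : language) := Structure {
  car :> metricType R;
  car_inh : inhabited car;
  car_complete : forall F : set_system car, ProperFilter F -> cauchy F ->
    exists x : car, F --> x;
  car_bounded : exists b : R, forall x y : car, mdist x y <= b;
  fint : forall f : fsym L, 'rV[car]_(far f) -> car;
  fint_unif : forall f, unif_continuous (@fint f);
  pint : forall P : psym L, 'rV[car]_(par P) -> R;
  pint_unif : forall P, unif_continuous (@pint P);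
  pint_bounded : forall P, exists b : R, forall c, `|@pint P c| <= b
}.

(* [formula R L A k] is the type of syntactic formulas with parameters in [A]
   and free variables indexed by ['I_k]; a quantifier binds the variable of
   index 0.  Every continuous function is a connective. *)
Inductive term (L : language) (A : Type) (k : nat) : Type :=
| tvar of 'I_k
| tpar of A
| tapp (f : fsym L) of ('I_(far f) -> term L A k).

Inductive formula (R : realType) (L : language) (A : Type) : nat -> Type :=
| fdist k of term L A k & term L A k : formula R L A k
| fpred k (P : psym L) of ('I_(par P) -> term L A k) : formula R L A k
| fconn k m (u : 'rV[R]_m -> R) of continuous u & ('I_m -> formula R L A k) :
    formula R L A k
| fsup k of formula R L A k.+1 : formula R L A k
| finf k of formula R L A k.+1 : formula R L A k.

Fixpoint trename (L : language) (A B : Type) (g : A -> B) k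
    (t : term L A k) : term L B k :=
  match t with
  | tvar i => tvar L B i
  | tpar a => tpar L k (g a)
  | tapp f ts => tapp (fun j => trename g (ts j))
  end.

Fixpoint frename (R : realType) (L : language) (A B : Type) (g : A -> B) k
    (phi : formula R L A k) : formula R L B k :=
  match phi with
  | fdist _ s t => fdist R (trename g s) (trename g t)
  | fpred _ P ts => fpred R (fun j => trename g (ts j))
  | fconn _ _ u cu ps => fconn cu (fun j => frename g (ps j))
  | fsup _ psi => fsup (frename g psi)
  | finf _ psi => finf (frename g psi)
  end.

Section Semantics.
Context (R : realType) (L : language) (C : structure R L).

Fixpoint teval (A : Type) (e : A -> C) k (t : term L A k) (c : 'rV[C]_k) : C :=
  match t with
  | tvar i => c ord0 i
  | tpar a => e a
  | tapp f ts => fint (\row_j teval e (ts j) c)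
  end.

(* The value of a formula when quantifiers range over [X] and a parameter [a]
   is interpreted as [e a].  When [X] is (the universe of) a substructure, this
   is the value of the formula in that substructure. *)
Fixpoint feval (X : set C) (A : Type) (e : A -> C) k (phi : formula R L A k) :
    'rV[C]_k -> R :=
  match phi with
  | fdist _ s t => fun c => mdist (teval e s c) (teval e t c)
  | fpred _ P ts => fun c => pint (\row_j teval e (ts j) c)
  | fconn _ _ u _ ps => fun c => u (\row_j feval X e (ps j) c)
  | fsup k psi => fun c =>
      sup [set feval X e psi (row_mx (const_mx x : 'rV_1) c) | x in X]
  | finf k psi => fun c =>
      inf [set feval X e psi (row_mx (const_mx x : 'rV_1) c) | x in X]
  end.

Definition tuples_in (X : set C) (k : nat) : set 'rV[C]_k :=
  [set c | forall i, X (c ord0 i)].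

Definition elem_substructure (M : set C) : Prop :=
  [/\ M !=set0, closed M,
      (forall (f : fsym L) c, tuples_in M c -> M (fint (f := f) c)) &
      forall k (phi : formula R L void k) c, tuples_in M c ->
        feval M (of_void C) phi c = feval setT (of_void C) phi c].

Definition elem_map (A : set C) (f : C -> C) : Prop :=
  forall k (phi : formula R L void k) c, tuples_in A c ->
    feval setT (of_void C) phi (map_mx f c) = feval setT (of_void C) phi c.

Definition automorphism (s : C -> C) : Prop :=
  [/\ bijective s,
      (forall x y, mdist (s x) (s y) = mdist x y),
      (forall (f : fsym L) c, s (fint (f := f) c) = fint (map_mx s c)) &
      forall (P : psym L) c, pint (P := P) (map_mx s c) = pint c].

Definition satisfiable (A : set C) k (Gamma : set (formula R L A k)) : Prop :=
  exists c, forall phi, Gamma phi -> feval setT set_val phi c = 0.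

Definition fin_satisfiable (A : set C) k (Gamma : set (formula R L A k)) :
    Prop :=
  forall F, finite_set F -> F `<=` Gamma -> forall e : R, 0 < e ->
    exists c, forall phi, F phi -> `|feval setT set_val phi c| < e.

End Semantics.

Definition card_lt (T U : Type) (X : set T) (Y : set U) : Prop :=
  X #<= Y /\ ~ (Y #<= X).

(* A monster model is a structure that is saturated and strongly homogeneous for
   an uncountable strong limit cardinal [K] exceeding the size of the language.
   Strong limit makes [K] large enough for every set of size less than [K] to be
   contained in an elementary substructure of size less than [K]: the size of a
   metric structure of density character [l] may be [l ^ aleph_0]. *)
Record is_monster (R : realType) (L : language) (K : Type)
    (C : structure R L) : Prop := IsMonster {
  monster_uncountable : card_lt [set: nat] [set: K];
  monster_strong_limit : forall X : set K, card_lt X [set: K] ->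
    card_lt [set Y | Y `<=` X] [set: K];
  monster_fsym : card_lt [set: fsym L] [set: K];
  monster_psym : card_lt [set: psym L] [set: K];
  monster_saturated : forall (A : set C) k (Gamma : set (formula R L A k)),
    card_lt A [set: K] -> fin_satisfiable Gamma -> satisfiable Gamma;
  monster_homogeneous : forall (A : set C) (f : C -> C),
    card_lt A [set: K] -> elem_map A f ->
    exists2 s : C -> C, automorphism s & forall a, A a -> s a = f a
}.

Record monster (R : realType) (L : language) := Monster {
  monster_str :> structure R L;
  monster_card : Type;
  monsterP : is_monster monster_card monster_str
}.

Section Rename.
Context (R : realType) (L : language) (C : structure R L).

Lemma teval_rename (A B : Type) (g : A -> B) (e : B -> C) k (t : term L A k) c :
  teval e (trename g t) c = teval (e \o g) t c.
Proof.
elim: t => //= f ts ih; congr fint; apply/matrixP => i j.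
by rewrite !mxE ih.
Qed.

Lemma feval_rename (X : set C) (A B : Type) (g : A -> B) (e : B -> C) k
    (phi : formula R L A k) c :
  feval X e (frename g phi) c = feval X (e \o g) phi c.
Proof.
elim: phi c => /= [{}k s t c|{}k P ts c|{}k m u cu ps ih c|{}k psi ih c
  |{}k psi ih c].
- by rewrite !teval_rename.
- by congr pint; apply/matrixP => i j; rewrite !mxE teval_rename.
- by congr u; apply/matrixP => i j; rewrite !mxE ih.
- by congr sup; apply: eq_imagel => x _; rewrite ih.
- by congr inf; apply: eq_imagel => x _; rewrite ih.
Qed.

End Rename.

Section Types.
Context (R : realType) (L : language) (C : monster R L).
Implicit Types (A B M : set C) (n : nat).

(* Parameter sets, and in particular models, are always small subsets of the
   monster; [tspace n A] is the usual space of types for small [A] only. *)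
Definition small A : Prop := card_lt A [set: monster_card C].

Definition model M : Prop := small M /\ elem_substructure M.

Definition tpfun n A (c : 'rV[C]_n) : {ptws formula R L A n -> R} :=
  fun phi => feval setT set_val phi c.

Definition tspace n A : Type := set_type (range (@tpfun n A)).

(* The logic topology is the topology of pointwise convergence on formulas. *)
HB.instance Definition _ n A :=
  Topological.copy (tspace n A) (set_type (range (@tpfun n A))).

Definition tp n A (c : 'rV[C]_n) : tspace n A :=
  SigSub (mem_set (imageT (@tpfun n A) c)).

Definition par_incl A B (AB : A `<=` B) (a : A) : B :=
  SigSub (mem_set (AB _ (set_valP a))).

Lemma restr_subproof n A B (AB : A `<=` B) (q : tspace n B) :
  (fun phi : formula R L A n => set_val q (frename (par_incl AB) phi))
    \in range (@tpfun n A).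
Proof.
apply/mem_set; have [c _ qE] := set_valP q; exists c => //.
apply/funext => phi; rewrite set_valE /= -qE /tpfun feval_rename.
by congr (feval _ _ _ _).
Qed.

Definition restr n A B (AB : A `<=` B) (q : tspace n B) : tspace n A :=
  SigSub (restr_subproof AB q).

Lemma restr_tp n A B (AB : A `<=` B) (c : 'rV[C]_n) :
  restr AB (tp B c) = tp A c.
Proof.
apply/val_inj/funext => phi /=.
by rewrite /tpfun set_valE /= /tpfun feval_rename; congr (feval _ _ _ _).
Qed.

Definition realizations n A (X : set (tspace n A)) M : set 'rV[C]_n :=
  [set c | tuples_in M c /\ X (tp A c)].

Definition tdist n (a b : 'rV[C]_n) : R :=
  \big[Order.max/0]_(i < n) mdist (a ord0 i) (b ord0 i).

Definition dtp n A (p q : tspace n A) : R :=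
  inf [set tdist a b | a in [set a | tp A a = p] & b in [set b | tp A b = q]].

(* Equal to [+oo] when [Q] is empty. *)
Definition dtp_set n A (q : tspace n A) (Q : set (tspace n A)) : \bar R :=
  ereal_inf [set (dtp q p)%:E | p in Q].

Definition thicken n A (Q : set (tspace n A)) (e : R) : set (tspace n A) :=
  [set q | (dtp_set q Q < e%:E)%E].

Definition definable_in n A (F Q : set (tspace n A)) : Prop :=
  [/\ closed Q, Q `<=` F &
      forall e : R, 0 < e -> exists U : set (tspace n A),
        [/\ open U, Q `<=` U `&` F & U `&` F `<=` thicken Q e]].

Definition definable n A (D : set (tspace n A)) : Prop := definable_in setT D.

Definition d_atomic_in n A (F : set (tspace n A)) (p : tspace n A) : Prop :=
  F p /\ definable_in F [set p].

Definition zeros n A (phi : tspace n A -> R) : set (tspace n A) :=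
  [set p | phi p = 0].

(* A formula over [A] is a continuous function on [tspace n A], not only the
   interpretation of a syntactic formula. *)
Definition zeroset n A (Z : set (tspace n A)) : Prop :=
  exists2 phi : tspace n A -> R, continuous phi & Z = zeros phi.

Definition dictionaric n A : Prop :=
  forall (p : tspace n A) (F : set (tspace n A)), closed F -> ~ F p ->
    exists D : set (tspace n A), [/\ definable D, D° p & D `&` F = set0].

(* Sets of types (formulas, respectively) over possibly unrelated parameter sets
   that define the same subset of (function on) the tuples of the monster. *)
Definition same_set n A B (D : set (tspace n A)) (D' : set (tspace n B)) :
    Prop :=
  realizations D setT = realizations D' setT.

Definition same_formula n A B (phi : tspace n A -> R) (phi' : tspace n B -> R) :
    Prop :=
  forall c, phi (tp A c) = phi' (tp B c).

Definition algebraic n A (X : set (tspace n A)) : Prop :=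
  forall M, model M -> A `<=` M -> compact (realizations X M).

Definition minimal n A (D : set (tspace n A)) : Prop :=
  [/\ definable D, ~ algebraic D &
      forall F G : set (tspace n A), zeroset F -> zeroset G ->
        F `<=` D -> G `<=` D -> F `&` G = set0 ->
        algebraic F \/ algebraic G].

Definition strongly_minimal n A (D : set (tspace n A)) : Prop :=
  definable D /\
  forall B (D' : set (tspace n B)), small B -> definable D' -> same_set D D' ->
    minimal D'.

Definition lt_algebraic n A (e : R) (p : tspace n A) : Prop :=
  forall M (AM : A `<=` M), model M -> forall q : tspace n M, restr AM q = p ->
    (dtp_set q [set tp M c | c in tuples_in M (k := n)] < e%:E)%E.

Definition pre_minimal n A (p : tspace n A) : Prop :=
  \forall e \near 0^'+, d_atomic_in [set q | ~ lt_algebraic e q] p.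

(* The quantification over [M] is vacuous: [lt_algebraic] already involves every
   model. *)
Definition approx_minimal n A (D : set (tspace n A)) (phi : tspace n A -> R) :
    Prop :=
  [/\ definable D, continuous phi, zeros phi `<=` D, ~ algebraic (zeros phi) &
      forall F G : set (tspace n A), zeroset F -> zeroset G ->
        F `<=` D -> G `<=` D -> F `&` G = set0 ->
        forall M, model M -> A `<=` M -> forall e : R, 0 < e ->
          F `&` [set p | phi p <= e] `<=` lt_algebraic e \/
          G `&` [set p | phi p <= e] `<=` lt_algebraic e].

Definition approx_strongly_minimal n A (D : set (tspace n A))
    (phi : tspace n A -> R) : Prop :=
  [/\ definable D, continuous phi &
      forall B (D' : set (tspace n B)) (phi' : tspace n B -> R), small B ->
        definable D' -> continuous phi' -> same_set D D' ->
        same_formula phi phi' -> approx_minimal D' phi'].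

Definition unique_nonalgebraic n A (X : set (tspace n A)) (p : tspace n A) :
    Prop :=
  [/\ X p, ~ algebraic [set p] &
      forall q, X q -> ~ algebraic [set q] -> q = p].

Definition set_points_to n A (D : set (tspace n A)) (p : tspace n A) : Prop :=
  unique_nonalgebraic D p.

Definition pair_points_to n A (D : set (tspace n A)) (phi : tspace n A -> R)
    (p : tspace n A) : Prop :=
  unique_nonalgebraic (zeros phi) p.

Definition params n A (D : set (tspace n A)) M : set C :=
  [set c ord0 i | c in realizations D M & i in [set: 'I_n]] `|` A.

Lemma params_sub n A (D : set (tspace n A)) M :
  A `<=` M -> params D M `<=` M.
Proof. by move=> AM x [[c [Mc _] [i _ <-]]|/AM //]; exact: Mc. Qed.

Definition set_over n A B (AB : A `<=` B) (D : set (tspace n A)) :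
    set (tspace n B) := restr AB @^-1` D.

Definition formula_over n A B (AB : A `<=` B) (phi : tspace n A -> R) :
    tspace n B -> R := phi \o restr AB.

End Types.

(* Main.v *)
(* If (D, P) is approximately minimal with generic type p, then separating p from
   another type q of D by zerosets shows that q is (<d)-algebraic as soon as
   P(q) <= d and d is small.  Hence, by compactness, the part of D where
   d/2 <= |P| <= d has a finite 3d-net in D(M); adding such nets for d = d0/2^k to
   {P = 0} gives a definable set whose points outside {P = 0} lie in D(M), so that
   p is its only non-algebraic type over every set of parameters over which (D, P)
   is approximately minimal.  This gives (ii) and (iii).

   For (i), let Q_d be the closed set of non-(<d)-algebraic types and choose a
   continuous f >= 0 with f(p) = 0 such that the types of Q_d where f is small are
   d-close to p.  A point of {f <= d} that is not d-close to {f < d/2} is not in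
   Q_d; definable sets that cover these points and avoid Q_d, for d = d0/2^k,
   together with {f = 0} form a definable D: points where f is small move in steps
   of geometrically decreasing size until they reach D.  As p is isolated in each
   D n Q_d, a continuous P exists with P(p) = 0 and P > d on D n Q_d minus p. *)
Require Import Defs.
From mathcomp Require Import all_boot all_order all_algebra.
From mathcomp Require Import all_classical all_reals all_analysis.
From mathcomp Require Import lra ring.

Set Implicit Arguments.
Unset Strict Implicit.
Unset Printing Implicit Defensive.

Import Order.TTheory GRing.Theory Num.Theory.
Import numFieldNormedType.Exports.

Local Open Scope classical_set_scope.
Local Open Scope card_scope.
Local Open Scope ring_scope.

(** * Small sets *)

(** The main obstacle is that (<d)-algebraicity quantifies over all models, whereas compactness
    yields a finite net in a single one. Such a net serves every other model M as well: it is
    replaced by a conjugate over M that is finitely satisfiable in M, and distances to this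
    conjugate are controlled by distances to tuples of M. Hence the (<d)-algebraic types form an
    open set, and [Q_d] is closed. The radius 3d of the nets is d + 2d: a net of radius d is found
    in M, and its points then walk into D(M) inside M by steps d, d/2, d/4, ... This walk is what
    keeps the parameters of E in D(M). Small models over given parameters come from Skolem hulls;
    taking the closure of a hull may raise its cardinality to a power, which a strong limit cardinal
    absorbs. Since a formula over A is any continuous function on types, P and f are built from
    Urysohn functions by a weighted supremum; syntactic formulas are needed to express conditions
    under quantifiers. *)

Definition embeds (X Y : Type) : Prop := exists f : X -> Y, injective f.

Lemma card_le_embeds (T U : Type) (A : set T) (B : set U) :
  A #<= B <-> embeds A B.
Proof.
split=> [/card_leP/injfunPex[f _ fI]|[f fI]].
  by exists f => x y; apply: fI; rewrite inE.
by apply/card_leP/injfunPex; exists f => // x y _ _; exact: fI.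
Qed.

Lemma embeds_trans Y X Z : embeds X Y -> embeds Y Z -> embeds X Z.
Proof. by move=> [f fI] [g gI]; exists (g \o f); exact: inj_comp. Qed.

Lemma embeds_val (T : Type) (A : set T) : embeds A T.
Proof. by exists val; exact: val_inj. Qed.

Lemma embeds_setT (T : Type) : embeds T [set: T].
Proof. by exists (fun x => SigSub (mem_set (Logic.I : setT x))) => x y []. Qed.

(** Zorn's lemma for graphs of partial injections: a maximal one that misses a point on both sides
    could be extended by that pair. *)
Lemma embeds_total (X Y : Type) : embeds X Y \/ embeds Y X.
Proof.
pose P (G : set (X * Y)) := (forall x y y', G (x, y) -> G (x, y') -> y = y') /\
  (forall x x' y, G (x, y) -> G (x', y) -> x = x').
have [F FP Ftot|G [[Gf Gi] Gmax]] := @Zorn_bigcup (X * Y) P.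
  have common p q : (\bigcup_(G in F) G) p -> (\bigcup_(G in F) G) q ->
      exists2 G, F G & G p /\ G q.
    move=> [G FG Gp] [H FH Hq].
    by have [GH|HG] := Ftot _ _ FG FH; [exists H|exists G] => //; split => //;
      [exact: GH|exact: HG].
  split=> [x y y'|x x' y] Fp Fq; have [G FG [Gp Gq]] := common _ _ Fp Fq.
    by have [Gf _] := FP _ FG; exact: Gf Gp Gq.
  by have [_ Gi] := FP _ FG; exact: Gi Gp Gq.
have [Xall|/existsNP[x0 x0P]] := pselect (forall x, exists y, G (x, y)).
  have [f fG] := choice Xall; left; exists f => x x' e.
  by apply: Gi (fG x) _; rewrite e; exact: fG.
have [Yall|/existsNP[y0 y0P]] := pselect (forall y, exists x, G (x, y)).
  have [f fG] := choice Yall; right; exists f => y y' e.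
  by apply: Gf (fG y) _; rewrite e; exact: fG.
exfalso; apply: (Gmax (G `|` [set (x0, y0)])).
  split; first by move=> p Gp; left.
  by move=> sub; apply: x0P; exists y0; apply: sub; right.
split=> [x y y'|x x' y] [p|[-> ->]] [q|[]].
- exact: Gf p q.
- by move=> ? ?; subst; exfalso; apply: x0P; exists y.
- by exfalso; apply: x0P; exists y'.
- by move=> ->.
- exact: Gi p q.
- by move=> ? ?; subst; exfalso; apply: y0P; exists x.
- by exfalso; apply: y0P; exists x'.
- by move=> ->.
Qed.

(* Doubling without choosing points: inl y is sent to {{y}} and inr y to
   {{y}, {}}. *)
Lemma embeds_sum_self (Y : Type) : embeds (Y + Y) (set (set Y)).
Proof.
exists (fun s => match s with
  | inl y => [set [set y]] | inr y => [set [set y]] `|` [set set0] end).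
have E (y : Y) : [set y] <> set0.
  by move=> /seteqP[/(_ y erefl)].
have S (y y' : Y) : [set y] = [set y'] -> y = y'.
  by move=> /seteqP[/(_ y erefl)].
move=> [y|y] [y'|y'] /seteqP[h1 h2].
- by congr inl; apply: S; exact: (h1 [set y] erefl).
- by exfalso; apply: (E y); rewrite -(h2 set0) //; right.
- by exfalso; apply: (E y'); rewrite -(h1 set0) //; right.
- by congr inr; apply: S; have [//|/E] := h1 [set y] (or_introl erefl).
Qed.

Lemma embeds_prod (X Y : Type) : embeds (X * Y) (set (X + Y)).
Proof.
exists (fun p => [set inl p.1] `|` [set inr p.2]) => -[x y] [x' y'] /= /seteqP[h _].
have [/= [->]|//] := h (inl x) (or_introl erefl).
by have [//|/= [->]] := h (inr y) (or_intror erefl).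
Qed.

Lemma embeds_fun (X Y : Type) : embeds (X -> Y) (set (X * Y)).
Proof.
exists (fun f => [set p | p.2 = f p.1]) => f g fg; apply/funext => x.
have : [set p | p.2 = f p.1] (x, f x) by [].
by rewrite fg.
Qed.

(* All nodes branch over [nat]: a tree is determined by the set of the pairs
   (path, label), which bounds the number of trees in terms of that of labels. *)
Inductive tree (X : Type) := Leaf of X | Node of X & (nat -> tree X).

Fixpoint tree_code (X : Type) (t : tree X) : set (seq nat * (X + X)) :=
  match t with
  | Leaf x => [set ([::], inl x)]
  | Node x f => [set ([::], inr x)] `|`
      [set p | if p.1 is i :: s then tree_code (f i) (s, p.2) else False]
  end.

Lemma tree_code_inj X : injective (@tree_code X).
Proof.
elim=> [x|x f ih] [x'|x' f'] /= /seteqP[h1 h2].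
- by have [->] := h1 _ erefl.
- by have := h2 _ (or_introl erefl).
- by have := h1 _ (or_introl erefl).
have -> : x = x' by have [[]|//] := h1 _ (or_introl erefl).
congr Node; apply/funext => i; apply: ih; apply/seteqP; split=> -[s l] hs.
  by have [//|//] := h1 (i :: s, l) (or_intror hs).
by have [//|//] := h2 (i :: s, l) (or_intror hs).
Qed.

(** Dedekind cuts: a real is determined by the rationals below it, which [pickle] numbers. *)
Lemma embeds_real (R : realType) : embeds R (set nat).
Proof.
exists (fun r => [set k | if choice.unpickle k is Some q then ratr q < r else False]).
pose cut (r : R) : set nat :=
  [set k | if choice.unpickle k is Some q then ratr (q : rat) < r else False].
have H (r s : R) : r < s -> cut r <> cut s.
  move=> rs; have [q] := rat_in_itvoo rs; rewrite in_itv /= => /andP[rq qs] e.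
  have : cut s (choice.pickle q) by rewrite /cut /= choice.pickleK.
  by rewrite -e /cut /= choice.pickleK ltNge (ltW rq).
by move=> r s e; have [/H|/H/nesym|//] := ltgtP r s.
Qed.

Section Small.
Variable K : Type.
Hypothesis uncountable : card_lt [set: nat] [set: K].
Hypothesis strong_limit : forall X : set K, card_lt X [set: K] ->
  card_lt [set Y | Y `<=` X] [set: K].

(** The analogue of [card_lt] for types instead of subsets, so that sums, products, function types
    and trees can be formed. *)
Definition small_type (X : Type) := embeds X K /\ ~ embeds K X.

Lemma small_typeP (T : Type) (A : set T) : card_lt A [set: K] <-> small_type A.
Proof.
rewrite /card_lt !card_le_embeds; split=> -[h1 h2]; split.
- exact: embeds_trans h1 (embeds_val _).
- by move=> h; apply: h2; exact: embeds_trans (embeds_val _) h.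
- exact: embeds_trans h1 (embeds_setT _).
- by move=> h; apply: h2; exact: embeds_trans (embeds_setT _) h.
Qed.

Lemma small_type_embeds Y X : embeds X Y -> small_type Y -> small_type X.
Proof.
move=> XY [YK KY]; split; first exact: embeds_trans XY YK.
by move=> KX; apply: KY; exact: embeds_trans KX XY.
Qed.

Lemma small_type_setT X : card_lt [set: X] [set: K] -> small_type X.
Proof. by move=> /small_typeP; apply: small_type_embeds; exact: embeds_setT. Qed.

(** The strong limit hypothesis speaks of subsets of [K]; an injection of [X] into [K] identifies
    [X] with one of them. *)
Lemma small_type_set X : small_type X -> small_type (set X).
Proof.
move=> [[f fI] KX]; have /strong_limit/small_typeP : card_lt (range f) [set: K].
  apply/small_typeP; split; first exact: embeds_val.
  move=> h; apply: KX; apply: embeds_trans h _.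
  have fP (y : range f) : exists x, f x = val y.
    by have [x _ <-] := set_valP y; exists x.
  have [g gP] := choice fP; exists g => y y' e; apply: val_inj.
  by rewrite /= -(gP y) -(gP y') e.
apply: small_type_embeds.
have sub (S : set X) : (f @` S) \in [set Y | Y `<=` range f].
  by apply/mem_set => _ [x _ <-]; exists x.
exists (fun S => SigSub (sub S)) => S S' [] SS'; apply/seteqP.
split=> x Sx.
  by have [y Sy /fI <-] : (f @` S') (f x) by rewrite -SS'; exists x.
by have [y Sy /fI <-] : (f @` S) (f x) by rewrite SS'; exists x.
Qed.

(** By comparability one summand embeds in the other, and a doubled type embeds in its double power
    set. *)
Lemma small_type_sum X Y : small_type X -> small_type Y -> small_type (X + Y).
Proof.
move=> sX sY; wlog XY : X Y sX sY / embeds X Y.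
  move=> h; have [/h|YX] := embeds_total X Y; first exact.
  apply: small_type_embeds (h _ _ sY sX YX).
  exists (fun s => match s with inl x => inr x | inr y => inl y end).
  by move=> [a|a] [b|b] //= [->].
apply: small_type_embeds (small_type_set (small_type_set sY)).
apply: embeds_trans (embeds_sum_self Y); move: XY => [f fI].
exists (fun s => match s with inl x => inl (f x) | inr y => inr y end).
by move=> [a|a] [b|b] //= [e]; congr (_ _); rewrite ?(fI _ _ e) ?e.
Qed.

Lemma small_type_prod X Y : small_type X -> small_type Y -> small_type (X * Y).
Proof.
move=> sX sY; apply: small_type_embeds (small_type_set (small_type_sum sX sY)).
exact: embeds_prod.
Qed.

Lemma small_type_fun X Y : small_type X -> small_type Y -> small_type (X -> Y).
Proof.
move=> sX sY; apply: small_type_embeds (small_type_set (small_type_prod sX sY)).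
exact: embeds_fun.
Qed.

Lemma small_type_nat : small_type nat.
Proof. exact: small_type_setT. Qed.

Lemma small_type_count (T : countType) : small_type T.
Proof.
apply: small_type_embeds small_type_nat.
by exists choice.pickle; exact: pcan_inj choice.pickleK.
Qed.

Lemma small_type_real (R : realType) : small_type R.
Proof.
exact: small_type_embeds (embeds_real R) (small_type_set small_type_nat).
Qed.

Lemma small_type_tree X : small_type X -> small_type (tree X).
Proof.
move=> sX.
apply: (small_type_embeds (Y := set (seq nat * (X + X)))).
  by exists (@tree_code X); exact: tree_code_inj.
by apply: small_type_set; apply: small_type_prod;
  [exact: small_type_count|exact: small_type_sum].
Qed.

Lemma small_type_image (X T : Type) (f : X -> T) : small_type X ->
  small_type (range f).
Proof.
apply: small_type_embeds.
have fP (y : range f) : exists x, f x = val y.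
  by have [x _ <-] := set_valP y; exists x.
have [g gP] := choice fP; exists g => y y' e; apply: val_inj.
by rewrite /= -(gP y) -(gP y') e.
Qed.

Lemma small_type_setU (T : Type) (A B : set T) : small_type A -> small_type B ->
  small_type (A `|` B).
Proof.
move=> sA sB.
have := small_type_image
  (fun s : A + B => match s with inl a => val a | inr b => val b end)
  (small_type_sum sA sB).
apply: small_type_embeds; apply/card_le_embeds/subset_card_le => x [Ax|Bx].
  by exists (inl (SigSub (mem_set Ax))).
by exists (inr (SigSub (mem_set Bx))).
Qed.

End Small.

(** * Formulas *)

Section Substitution.
Context (R : realType) (L : language).

Fixpoint tsubst (A B : Type) k m (g : A -> term L B m) (s : 'I_k -> term L B m)
    (t : term L A k) : term L B m :=
  match t with
  | tvar i => s i
  | tpar a => g a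
  | tapp f ts => tapp (fun j => tsubst g s (ts j))
  end.

Definition tlift (B : Type) m : term L B m -> term L B m.+1 :=
  tsubst (fun b => tpar L m.+1 b) (fun i => tvar L B (lift ord0 i)).

Definition slift (B : Type) k m (s : 'I_k -> term L B m) (i : 'I_k.+1) :
    term L B m.+1 :=
  if unlift ord0 i is Some j then tlift (s j) else tvar L B ord0.

(** Parameters are replaced by terms too, which allows turning them into variables and a formula
    over [A] into one without parameters. Under a quantifier every substituted term is lifted past
    the bound variable of index 0. *)
Fixpoint fsubst (A B : Type) k (phi : formula R L A k) :
    forall m, (A -> term L B m) -> ('I_k -> term L B m) -> formula R L B m :=
  match phi with
  | fdist _ t u => fun m g s => fdist R (tsubst g s t) (tsubst g s u)
  | fpred _ P ts => fun m g s => fpred R (fun j => tsubst g s (ts j))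
  | fconn _ _ u cu ps => fun m g s => fconn cu (fun j => fsubst (ps j) g s)
  | fsup _ psi => fun m g s => fsup (fsubst psi (fun a => tlift (g a)) (slift s))
  | finf _ psi => fun m g s => finf (fsubst psi (fun a => tlift (g a)) (slift s))
  end.

Variable C : structure R L.

Lemma row_mx_head (T : Type) k (x : T) (c : 'rV[T]_k) :
  (row_mx (const_mx x : 'rV_1) c : 'rV_(k.+1)) ord0 ord0 = x.
Proof.
have -> : (ord0 : 'I_(k.+1)) = @lshift 1 k ord0 by apply/val_inj.
by rewrite (row_mxEl (const_mx x : 'rV_1) c) mxE.
Qed.

Lemma row_mx_tail (T : Type) k (x : T) (c : 'rV[T]_k) j :
  (row_mx (const_mx x : 'rV_1) c : 'rV_(k.+1)) ord0 (lift ord0 j) = c ord0 j.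
Proof.
have -> : lift ord0 j = @rshift 1 k j by apply/val_inj.
by rewrite (row_mxEr (const_mx x : 'rV_1) c).
Qed.

Lemma teval_subst (A B : Type) k m (e : B -> C) (g : A -> term L B m)
    (s : 'I_k -> term L B m) t c :
  teval e (tsubst g s t) c =
  teval (fun a => teval e (g a) c) t (\row_j teval e (s j) c).
Proof.
elim: t => [i|a|f ts ih] //=; first by rewrite mxE.
by congr fint; apply/rowP => j; rewrite !mxE ih.
Qed.

Lemma teval_lift (B : Type) m (e : B -> C) (t : term L B m) (x : C) c :
  teval e (tlift t) (row_mx (const_mx x : 'rV_1) c) = teval e t c.
Proof.
rewrite teval_subst; congr (teval _ _ _); apply/rowP => j.
by rewrite mxE /= row_mx_tail.
Qed.

Lemma slift_eval (B : Type) k m (e : B -> C) (s : 'I_k -> term L B m) (x : C) c :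
  \row_j teval e (slift s j) (row_mx (const_mx x : 'rV_1) c) =
  row_mx (const_mx x : 'rV_1) (\row_j teval e (s j) c).
Proof.
apply/rowP => j; rewrite mxE /slift.
case: (unliftP ord0 j) => [i ->|->]; last by rewrite row_mx_head /= row_mx_head.
by rewrite teval_lift row_mx_tail mxE.
Qed.

Lemma eq_feval_env (X : set C) (A : Type) k (phi : formula R L A k) (e e' : A -> C) c :
  e =1 e' -> feval X e phi c = feval X e' phi c.
Proof. by move=> /funext ->. Qed.

Lemma feval_subst (X : set C) (A B : Type) k (phi : formula R L A k) m
    (e : B -> C) (g : A -> term L B m) (s : 'I_k -> term L B m) c :
  feval X e (fsubst phi g s) c =
  feval X (fun a => teval e (g a) c) phi (\row_j teval e (s j) c).
Proof.
elim: phi m e g s c => /= {k} [k t u|k P ts|k l u cu ps ih|k psi ih|k psi ih] m e g s c.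
- by rewrite !teval_subst.
- by congr pint; apply/rowP => j; rewrite !mxE teval_subst.
- by congr u; apply/rowP => j; rewrite !mxE ih.
- congr sup; apply: eq_imagel => x _; rewrite ih slift_eval.
  by apply: eq_feval_env => a; rewrite teval_lift.
- congr inf; apply: eq_imagel => x _; rewrite ih slift_eval.
  by apply: eq_feval_env => a; rewrite teval_lift.
Qed.

End Substitution.

(** * Bounds and moduli of uniform continuity *)

Section Bounds.
Context (R : realType).

Lemma fin_pos (I : finType) (P : I -> R -> Prop) :
  (forall i, exists2 d, 0 < d & forall d', 0 < d' -> d' <= d -> P i d') ->
  exists2 d, 0 < d & forall i, P i d.
Proof.
move=> h; have {}h i : exists d : R, 0 < d /\ forall d', 0 < d' -> d' <= d -> P i d'.
  by have [d ? ?] := h i; exists d.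
have [f fP] := choice h.
have pos : 0 < \big[Order.min/1]_i f i.
  apply: (big_ind (fun x : R => 0 < x)) => // [x y x0 y0|i _]; first by rewrite lt_min x0.
  by have [] := fP i.
exists (\big[Order.min/1]_i f i) => // i; have [_ /(_ _ pos)] := fP i; apply.
exact: bigmin_le.
Qed.

Lemma fin_bound (I : finType) (P : I -> R -> Prop) :
  (forall i, exists b, forall b', b <= b' -> P i b') ->
  exists b, forall i, P i b.
Proof.
move=> /choice[f fP].
exists (\big[Order.max/0]_i f i) => i; apply: fP.
exact: le_bigmax.
Qed.

(** A connective is merely continuous on the whole space; boundedness and uniform continuity hold on
    a compact box, and the values of the subformulas lie in one. *)
Lemma continuous_box m (u : 'rV[R]_m -> R) (b : R) : continuous u ->
  (exists B : R, forall v : 'rV[R]_m, (forall i, `|v ord0 i| <= b) -> `|u v| <= B) /\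
  (forall e, 0 < e -> exists2 d, 0 < d &
    forall v w : 'rV[R]_m, (forall i, `|v ord0 i| <= b) ->
      (forall i, `|v ord0 i - w ord0 i| < d) -> `|u v - u w| < e).
Proof.
move=> cu; pose K := [set v : 'rV[R]_m | forall i, `[- b, b]%classic (v ord0 i)].
have cK : compact K.
  by apply: (@rV_compact _ m (fun=> `[- b, b]%classic)) => i; exact: segment_compact.
have inK (v : 'rV[R]_m) : (forall i, `|v ord0 i| <= b) -> K v.
  by move=> h i; rewrite /= in_itv /= -ler_norml.
split.
  have : compact (u @` K).
    by apply: continuous_compact => //; exact: continuous_subspaceT.
  move=> /compact_bounded[B [_ hB]]; exists (B + 1) => v /inK Kv.
  by apply: (hB (B + 1)); [rewrite ltrDl|exists v].
move=> e e0.
have /compact_near_coveringP nc := cK.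
have [|d /= d0 hd] := nc R (0^'+)
    (fun d (v : 'rV[R]_m) => forall w : 'rV[R]_m,
      (forall i, `|v ord0 i - w ord0 i| < d) -> `|u v - u w| < e) _.
  move=> v Kv; have /cvgrPdist_lt/(_ (e / 2)) : u w @[w --> v] --> u v by exact: cu.
  rewrite divr_gt0// => /(_ isT) /nbhs_ballP[r /= r0 hr].
  have r20 : 0 < r / 2 by rewrite divr_gt0.
  exists (ball v (r / 2), [set d | d < r / 2]) => /=.
    by split; [exact: nbhsx_ballx|exact: nbhs_right_lt].
  move=> [v' d] /= [v'v dr] w h.
  have b1 : ball v r v' by apply: le_ball v'v; rewrite ler_pdivrMr// ler_peMr ?ler1n// ltW.
  have b2 : ball v r w.
    rewrite [r]splitr; apply: ball_triangle v'v _; split => // i j.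
    by rewrite (ord1 i) /ball /=; apply: lt_trans (h j) dr.
  have := hr _ b1; have := hr _ b2 => h2 h1.
  by rewrite [e]splitr (le_lt_trans (ler_distD (u v) _ _))// ltrD// distrC.
exists (d / 2); first by rewrite divr_gt0.
move=> v w vb vw; apply: hd (inK _ vb) w vw => //=.
  by rewrite sub0r normrN gtr0_norm ?divr_gt0// ltr_pdivrMr// ltr_pMr// ltr1n.
by rewrite divr_gt0.
Qed.

(** The bound [b] ensures that both suprema are genuine: [sup] of an unbounded set is a default
    value. *)
Lemma sup_le_dist (T : Type) (X : set T) (f g : T -> R) (b d : R) :
  X !=set0 -> (forall x, `|f x| <= b) -> (forall x, `|g x| <= b) ->
  (forall x, X x -> `|f x - g x| <= d) ->
  `|sup [set f x | x in X] - sup [set g x | x in X]| <= d.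
Proof.
have H h : X !=set0 -> (forall x, `|h x| <= b) -> has_sup [set h x | x in X].
  move=> [x Xx] hb; split; first by exists (h x); exists x.
  by exists b => _ [y _ <-]; exact: le_trans (ler_norm _) (hb y).
have one f' g' : X !=set0 -> (forall x, `|f' x| <= b) -> (forall x, `|g' x| <= b) ->
  (forall x, X x -> `|f' x - g' x| <= d) ->
  sup [set f' x | x in X] - sup [set g' x | x in X] <= d.
  move=> X0 fb gb fg; rewrite lerBlDr; apply: ge_sup.
    by have [] := H _ X0 fb.
  move=> _ [x Xx <-]; have := ler_normlW (fg x Xx); rewrite lerBlDr => h.
  apply: le_trans h _; rewrite lerD2l; apply: sup_ubound.
    by have [] := H _ X0 gb.
  by exists x.
move=> X0 fb gb fg; apply/ler_normlP; split; last exact: one.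
by rewrite opprB; apply: one => // x Xx; rewrite distrC; exact: fg.
Qed.

Lemma inf_le_dist (T : Type) (X : set T) (f g : T -> R) (b d : R) :
  X !=set0 -> (forall x, `|f x| <= b) -> (forall x, `|g x| <= b) ->
  (forall x, X x -> `|f x - g x| <= d) ->
  `|inf [set f x | x in X] - inf [set g x | x in X]| <= d.
Proof.
move=> X0 fb gb fg; rewrite /inf -opprD normrN.
have E h : -%R @` [set h x | x in X] = [set - h x | x in X] by rewrite image_comp.
rewrite !E; apply: (@sup_le_dist _ _ _ _ b) => //.
- by move=> x; rewrite normrN.
- by move=> x; rewrite normrN.
- by move=> x Xx; rewrite -opprD normrN fg.
Qed.

Lemma sup_bounded (T : Type) (X : set T) (f : T -> R) (b : R) : X !=set0 ->
  (forall x, X x -> `|f x| <= b) -> `|sup [set f x | x in X]| <= b.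
Proof.
move=> [x0 Xx0] fb; apply/ler_normlP; split.
  rewrite lerNl; have := fb _ Xx0 => /ler_normlP[h _].
  rewrite lerNl in h; apply: le_trans h _; apply: sup_ubound; last by exists x0.
  by exists b => _ [y Xy <-]; exact: le_trans (ler_norm _) (fb y Xy).
apply: ge_sup; first by exists (f x0); exists x0.
by move=> _ [y Xy <-]; exact: le_trans (ler_norm _) (fb y Xy).
Qed.

Lemma inf_bounded (T : Type) (X : set T) (f : T -> R) (b : R) : X !=set0 ->
  (forall x, X x -> `|f x| <= b) -> `|inf [set f x | x in X]| <= b.
Proof.
move=> X0 fb; rewrite /inf normrN image_comp.
by apply: sup_bounded => // x Xx /=; rewrite normrN fb.
Qed.

End Bounds.

Section Regularity.
Context (R : realType) (L : language) (C : structure R L).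

Definition near_row k (d : R) (c c' : 'rV[C]_k) : Prop :=
  forall i, mdist (c ord0 i) (c' ord0 i) < d.

Lemma mdistC (x y : C) : mdist x y = mdist y x.
Proof. exact: metric_sym. Qed.

Lemma near_row_le k d d' (c c' : 'rV[C]_k) : d <= d' -> near_row d c c' -> near_row d' c c'.
Proof. by move=> dd' h i; exact: lt_le_trans (h i) dd'. Qed.

Lemma near_row_ball k (d : R) (c c' : 'rV[C]_k) : 0 < d ->
  near_row d c c' <-> ball c d c'.
Proof.
move=> d0; split=> [h|[_ h] i].
  by split=> // i j; rewrite (ord1 i) ballEmdist; exact: h.
by have := h ord0 i; rewrite ballEmdist.
Qed.

Lemma near_row_cons k d (x : C) (c c' : 'rV[C]_k) : 0 < d -> near_row d c c' ->
  @near_row k.+1 d (row_mx (const_mx x : 'rV_1) c) (row_mx (const_mx x : 'rV_1) c').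
Proof.
move=> d0 h i; case: (unliftP ord0 i) => [j ->|->].
  by rewrite !row_mx_tail; exact: h.
by rewrite !row_mx_head mdistxx.
Qed.

Lemma fint_near (f : Defs.fsym L) e : 0 < e -> exists2 d, 0 < d &
  forall c c' : 'rV[C]_(far f), near_row d c c' -> mdist (fint c) (fint c') < e.
Proof.
move=> e0; have /(unif_continuousP (R := R))/(_ _ e0)[d d0 h] := @fint_unif R L C f.
exists d => // c c' /(near_row_ball _ _ d0) cc'.
by have := h (c, c') cc'; rewrite ballEmdist.
Qed.

Lemma pint_near (P : psym L) e : 0 < e -> exists2 d, 0 < d &
  forall c c' : 'rV[C]_(par P), near_row d c c' -> `|pint c - pint c'| < e.
Proof.
move=> e0; have /(unif_continuousP (R := R))/(_ _ e0)[d d0 h] := @pint_unif R L C P.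
by exists d => // c c' /(near_row_ball _ _ d0) cc'; exact: (h (c, c')).
Qed.

Lemma teval_near (A : Type) (e : A -> C) k (t : term L A k) eps : 0 < eps ->
  exists2 d, 0 < d & forall c c', near_row d c c' ->
    mdist (teval e t c) (teval e t c') < eps.
Proof.
elim: t eps => /= [i|a|f ts ih] eps eps0.
- by exists eps => // c c' h; exact: h.
- by exists 1 => // c c' _; rewrite mdistxx.
have [d1 d10 h1] := fint_near f eps0.
have [|d d0 h] := @fin_pos R _ (fun i d => forall c c', near_row d c c' ->
    mdist (teval e (ts i) c) (teval e (ts i) c') < d1).
  move=> i; have [d d0 h] := ih i _ d10; exists d => // d' _ d'd c c' cc'.
  by apply: h; exact: near_row_le cc'.
exists d => // c c' cc'; apply: h1 => i; rewrite !mxE; exact: h.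
Qed.

(** The bound depends on the formula alone, so quantifiers are genuine suprema and infima over every
    nonempty [X]. *)
Lemma feval_bounded (A : Type) k (phi : formula R L A k) : exists b : R,
  forall (X : set C) (e : A -> C) c, X !=set0 -> `|feval X e phi c| <= b.
Proof.
elim: phi => {k} [k s t|k P ts|k m u cu ps ih|k psi [b ih]|k psi [b ih]].
- have [b hb] := car_bounded C; exists b => X e c _ /=.
  by rewrite ger0_norm ?mdist_ge0.
- have [b hb] := @pint_bounded R L C P; by exists b => X e c _ /=.
- have [|b hb] := @fin_bound R _ (fun i b => forall (X : set C) (e : A -> C) c,
      X !=set0 -> `|feval X e (ps i) c| <= b).
    move=> i; have [b hb] := ih i; exists b => b' bb' X e c X0.
    exact: le_trans (hb X e c X0) bb'.
  have [[B hB] _] := continuous_box b cu.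
  by exists B => X e c X0 /=; apply: hB => i; rewrite mxE hb.
- by exists b => X e c X0 /=; apply: sup_bounded => // x Xx; exact: ih.
- by exists b => X e c X0 /=; apply: inf_bounded => // x Xx; exact: ih.
Qed.

Lemma feval_near (A : Type) (e : A -> C) (X : set C) k (phi : formula R L A k) :
  X !=set0 -> forall eps, 0 < eps -> exists2 d, 0 < d & forall c c',
    near_row d c c' -> `|feval X e phi c - feval X e phi c'| < eps.
Proof.
move=> X0; elim: phi => {k} [k s t|k P ts|k m u cu ps ih|k psi ih|k psi ih] eps eps0.
- have e20 : 0 < eps / 2 by rewrite divr_gt0.
  have [d1 d10 h1] := teval_near e s e20; have [d2 d20 h2] := teval_near e t e20.
  exists (Order.min d1 d2); first by rewrite lt_min d10.
  have m1 : Order.min d1 d2 <= d1 by rewrite ge_min lexx.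
  have m2 : Order.min d1 d2 <= d2 by rewrite ge_min lexx orbT.
  move=> c c' cc' /=; have := h1 c c' (near_row_le m1 cc').
  have := h2 c c' (near_row_le m2 cc').
  move: (teval e s c) (teval e t c) (teval e s c') (teval e t c') => x y x' y' hy hx.
  have := metric_triangle x x' y; have := metric_triangle x' y' y.
  have := metric_triangle x' x y'; have := metric_triangle x y y'.
  rewrite (mdistC y' y) (mdistC x' x) => h3 h4 h5 h6.
  by rewrite ltr_norml; apply/andP; split; lra.
- have [d1 d10 h1] := pint_near P eps0.
  have [|d d0 h] := @fin_pos R _ (fun i d => forall c c', near_row d c c' ->
    mdist (teval e (ts i) c) (teval e (ts i) c') < d1).
    move=> i; have [d d0 h] := teval_near e (ts i) d10.
    by exists d => // d' _ d'd c c' cc'; apply: h; exact: near_row_le cc'.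
  by exists d => // c c' cc' /=; apply: h1 => i; rewrite !mxE; exact: h.
- have [|b hb] := @fin_bound R _ (fun i b => forall c, `|feval X e (ps i) c| <= b).
    move=> i; have [b hb] := feval_bounded (ps i); exists b => b' bb' c.
    exact: le_trans (hb X e c X0) bb'.
  have [_ /(_ _ eps0)[d1 d10 h1]] := continuous_box b cu.
  have [|d d0 h] := @fin_pos R _ (fun i d => forall c c', near_row d c c' ->
    `|feval X e (ps i) c - feval X e (ps i) c'| < d1).
    move=> i; have [d d0 h] := ih i _ d10.
    by exists d => // d' _ d'd c c' cc'; apply: h; exact: near_row_le cc'.
  exists d => // c c' cc' /=; apply: h1 => i; rewrite !mxE; first exact: hb.
  exact: h.
- have e20 : 0 < eps / 2 by rewrite divr_gt0.
  have [d d0 h] := ih _ e20; have [b hb] := feval_bounded psi; exists d => // c c' cc' /=.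
  apply: (@le_lt_trans _ _ (eps / 2)); last by rewrite ltr_pdivrMr// ltr_pMr// ltr1n.
  apply: (@sup_le_dist _ _ _ _ _ b) => // [x|x|x Xx]; [exact: hb|exact: hb|].
  by apply/ltW/h; exact: near_row_cons.
- have e20 : 0 < eps / 2 by rewrite divr_gt0.
  have [d d0 h] := ih _ e20; have [b hb] := feval_bounded psi; exists d => // c c' cc' /=.
  apply: (@le_lt_trans _ _ (eps / 2)); last by rewrite ltr_pdivrMr// ltr_pMr// ltr1n.
  apply: (@inf_le_dist _ _ _ _ _ b) => // [x|x|x Xx]; [exact: hb|exact: hb|].
  by apply/ltW/h; exact: near_row_cons.
Qed.

(** A strict upper bound turns an infimum into an existential quantifier whether or not the infimum
    is attained; existence statements are therefore phrased below as a value [< r]. *)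
Lemma finf_lt (A : Type) (e : A -> C) (X : set C) k (psi : formula R L A k.+1) c r :
  X !=set0 -> feval X e (finf psi) c < r <->
  exists2 x, X x & feval X e psi (row_mx (const_mx x : 'rV_1) c) < r.
Proof.
move=> X0; have [b hb] := feval_bounded psi.
have lb : has_inf [set feval X e psi (row_mx (const_mx x : 'rV_1) c) | x in X].
  split.
    case: X0 => x Xx.
    by exists (feval X e psi (row_mx (const_mx x : 'rV_1) c)); exists x.
  exists (- b) => _ [y _ <-]; have := hb X e (row_mx (const_mx y : 'rV_1) c) X0.
  by rewrite ler_norml => /andP[].
split=> /= [/inf_lt|[x Xx]].
  by move=> /(_ lb.1)[_ [x Xx <-] ?]; exists x.
by apply: le_lt_trans; apply: ge_inf; [exact: lb.2|exists x].
Qed.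

Fixpoint finfs (A : Type) m k : formula R L A (m + k) -> formula R L A k :=
  match m return formula R L A (m + k) -> formula R L A k with
  | 0 => id
  | m'.+1 => fun psi => finfs (@finf R L A (m' + k) psi)
  end.

Lemma finfs_lt (A : Type) (e : A -> C) (X : set C) m k
    (psi : formula R L A (m + k)) c r : X !=set0 ->
  feval X e (finfs psi) c < r <->
  exists2 b : 'rV[C]_m, tuples_in X b & feval X e psi (row_mx b c) < r.
Proof.
move=> X0; elim: m psi => [|m ih] psi /=.
  have rE (b : 'rV[C]_0) : row_mx b c = c.
    apply/rowP => i; have -> : i = @rshift 0 k i by apply/val_inj.
    by rewrite row_mxEr; congr (c _ _); apply/val_inj.
  split=> [h|[b _]]; last by rewrite rE.
  case: X0 => x Xx; exists (const_mx x); first by move=> i; rewrite mxE.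
  by rewrite rE.
have rE (x : C) (b : 'rV[C]_m) : (row_mx (const_mx x : 'rV_1) (row_mx b c) : 'rV_(m + k).+1) =
   row_mx (row_mx (const_mx x : 'rV_1) b : 'rV_(m.+1)) c.
  apply/rowP => i; case: (unliftP ord0 i) => [j ->|->].
    rewrite row_mx_tail; move: (j : 'I_(m + k)) => {}j.
    rewrite -[j]splitK; case: (fintype.split j) => l /=.
      rewrite row_mxEl.
      have -> : lift ord0 (lshift k l) = @lshift m.+1 k (lift ord0 l).
        by apply/val_inj.
      by rewrite (@row_mxEl _ _ m.+1 k) row_mx_tail.
    rewrite row_mxEr; have -> : lift ord0 (rshift m l) = @rshift m.+1 k l by apply/val_inj.
    by rewrite (@row_mxEr _ _ m.+1 k).
  have -> : ord0 = @lshift m.+1 k ord0 by apply/val_inj.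
  rewrite (@row_mxEl _ _ m.+1 k) row_mx_head.
  have -> : @lshift m.+1 k ord0 = ord0 by apply/val_inj.
  by rewrite row_mx_head.
split.
  move=> /ih[b Xb] /finf_lt[//|x Xx h].
  exists (row_mx (const_mx x : 'rV_1) b : 'rV_(m.+1)).
    move=> i; case: (unliftP ord0 i) => [j ->|->]; first by rewrite row_mx_tail.
    by rewrite row_mx_head.
  by rewrite -rE.
move=> [b Xb h]; apply/ih; pose b' := \row_j b ord0 (lift ord0 j).
exists b'; first by move=> i; rewrite mxE; exact: Xb.
apply/finf_lt => //; exists (b ord0 ord0); first exact: Xb.
rewrite rE; suff -> : (row_mx (const_mx (b ord0 ord0) : 'rV_1) b' : 'rV_(m.+1)) = b by [].
apply/rowP => i; case: (unliftP ord0 i) => [j ->|->]; last by rewrite row_mx_head.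
by rewrite row_mx_tail mxE.
Qed.

End Regularity.

(** * The Loewenheim-Skolem theorem *)

Section FormulaCode.
Context (R : realType) (L : language) (A : Type).

(** The first number is the count of free variables of a formula, the second an arity, a variable
    index or a tag that tells constructors apart. Connectives are stored as functions of infinite
    sequences, so that the type does not depend on their arity. *)
Definition label : Type :=
  nat * (nat * (unit + (Defs.fsym L + (psym L + (A + ((nat -> R) -> R)))))).

(** Pads a finite family to the [nat]-indexed branching of [tree]; it likewise pads a row vector to
    the sequence that a stored connective expects. *)
Definition children T (x0 : T) m (f : 'I_m -> T) (j : nat) : T :=
  if insub j is Some i then f i else x0.

Lemma children_inj T (x0 : T) m (f : 'I_m -> T) g :
  children x0 f = children x0 g -> f = g.
Proof.
move=> fg; apply/funext => i; have := congr1 (fun h => h (val i)) fg.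
by rewrite /children valK.
Qed.

Let leaf0 : tree label := Leaf (0%N, (0%N, inl tt)).

Fixpoint tcode k (t : term L A k) : tree label :=
  match t with
  | tvar i => Leaf (0%N, (val i, inl tt))
  | tpar a => Leaf (0%N, (0%N, inr (inr (inr (inl a)))))
  | tapp f ts => Node (0%N, (0%N, inr (inl f))) (children leaf0 (fun j => tcode (ts j)))
  end.

Lemma tcode_inj k : injective (@tcode k).
Proof.
elim=> [i|a|f ts ih] [i'|a'|f' ts'] //=.
- by move=> [/val_inj ->].
- by move=> [->].
move=> [ff']; subst f' => ce; have e := children_inj ce.
by congr tapp; apply/funext => j; apply: ih; have := congr1 (fun h => h j) e.
Qed.

Fixpoint fcode k (phi : formula R L A k) : tree label :=
  match phi with
  | fdist k s t => Node (k, (0%N, inl tt))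
      (fun j => if j is 0%N then tcode s else tcode t)
  | fpred k P ts => Node (k, (0%N, inr (inr (inl P))))
      (children leaf0 (fun j => tcode (ts j)))
  | fconn k m u _ ps =>
      Node (k, (m, inr (inr (inr (inr (fun s => u (\row_i s (val i))))))))
        (children leaf0 (fun j => fcode (ps j)))
  | fsup k psi => Node (k, (1%N, inl tt)) (fun=> fcode psi)
  | finf k psi => Node (k, (2%N, inl tt)) (fun=> fcode psi)
  end.

Lemma inj_existT (P : nat -> Type) k (x y : P k) : existT P k x = existT P k y -> x = y.
Proof. exact: (Eqdep_dec.inj_pair2_eq_dec nat PeanoNat.Nat.eq_dec P k x y). Qed.

Lemma fcode_inj k (phi : formula R L A k) k' (phi' : formula R L A k') :
  fcode phi = fcode phi' -> existT _ k phi = existT _ k' phi'.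
Proof.
elim: phi k' phi' => {k} [k s t|k P ts|k m u cu ps ih|k psi ih|k psi ih] k'
  [{}k' s' t'|{}k' P' ts'|{}k' m' u' cu' ps'|{}k' psi'|{}k' psi'] //=.
- move=> [kk']; subst k' => e.
  have es := tcode_inj (congr1 (fun h => h 0%N) e).
  by have et := tcode_inj (congr1 (fun h => h 1%N) e); rewrite es et.
- move=> [kk' PP']; subst k' P' => ce; have e := children_inj ce; congr existT; congr fpred.
  by apply/funext => j; apply: tcode_inj; have := congr1 (fun h => h j) e.
- move=> [kk' mm' uu']; subst k' m' => ce; have e := children_inj ce; congr existT.
  have uE : u = u'.
    apply/funext => v; have := congr1 (fun h => h (children 0%R (fun j => v ord0 j))) uu'.
    by congr (_ = _); [congr u|congr u']; apply/rowP => i; rewrite mxE /children valK.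
  subst u'; have -> : cu = cu' by exact: Prop_irrelevance.
  congr fconn; apply/funext => j; apply: inj_existT; apply: ih.
  by have := congr1 (fun h => h j) e.
- move=> [kk']; subst k' => e.
  by have ep := inj_existT (ih _ _ (congr1 (fun h => h 0%N) e)); rewrite ep.
- move=> [kk']; subst k' => e.
  by have ep := inj_existT (ih _ _ (congr1 (fun h => h 0%N) e)); rewrite ep.
Qed.

End FormulaCode.

(** * Tarski-Vaught test and Skolem hulls *)

Section LoewenheimSkolem.
Context (R : realType) (L : language) (C : monster R L).

Let K := monster_card C.
Let Kunc : card_lt [set: nat] [set: K] := monster_uncountable (monsterP C).
Let Kslim := monster_strong_limit (monsterP C).

Notation small_ty := (small_type K).

Lemma smallP (A : set C) : small A <-> small_ty A.
Proof. exact: small_typeP. Qed.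

Lemma small_formulas (A : Type) : small_ty A -> small_ty {k & formula R L A k}.
Proof.
move=> sA; apply: (@small_type_embeds _ (tree (label R L A))).
  by exists (fun p => fcode (projT2 p)) => -[k phi] [k' phi'] /= /fcode_inj.
have sR := small_type_real Kunc Kslim R; have sN := small_type_nat Kunc.
apply: small_type_tree => //; do 2! apply: small_type_prod => //.
apply: small_type_sum => //; first exact: small_type_count Kunc _.
apply: small_type_sum => //; first exact: (small_type_setT (monster_fsym (monsterP C))).
apply: small_type_sum => //; first exact: (small_type_setT (monster_psym (monsterP C))).
by apply: small_type_sum => //; do 2! apply: small_type_fun => //.
Qed.

Definition fneg (A : Type) k (phi : formula R L A k) : formula R L A k :=
  @fconn R L A k 1 (fun v => - v ord0 ord0)
    (fun v => continuousN (@coord_continuous R 1 1 ord0 ord0 v)) (fun=> phi).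

Lemma feval_fneg (A : Type) (X : set C) (e : A -> C) k (phi : formula R L A k) c :
  feval X e (fneg phi) c = - feval X e phi c.
Proof. by rewrite /= mxE. Qed.

Lemma fsupE (A : Type) (X : set C) (e : A -> C) k (psi : formula R L A k.+1) c :
  feval X e (fsup psi) c = - feval X e (finf (fneg psi)) c.
Proof.
rewrite /= /inf opprK; congr sup; rewrite image_comp.
by apply: eq_imagel => x _ /=; rewrite mxE opprK.
Qed.

(** The values of an infimum in [M] and in [C] have the same strict upper bounds: one direction is
    the induction hypothesis, the other the test. Closure under a function symbol f is the test for
    the formula d(x, f(c)), whose infimum is 0, because [M] is closed. *)
Lemma tarski_vaught (M : set C) : M !=set0 -> closed M ->
  (forall k (phi : formula R L void k.+1) c r, tuples_in M c ->
    feval setT (of_void C) (finf phi) c < r ->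
    exists2 x, M x &
      feval setT (of_void C) phi (row_mx (const_mx x : 'rV_1) c) < r) ->
  elem_substructure M.
Proof.
move=> M0 clM tv; have T0 : [set: C] !=set0 by case: M0 => x _; exists x.
have Mcons k (x : C) (c : 'rV[C]_k) : M x -> tuples_in M c ->
    @tuples_in R L C M k.+1 (row_mx (const_mx x : 'rV_1) c).
  move=> Mx Mc i; case: (unliftP ord0 i) => [j ->|->]; last by rewrite row_mx_head.
  by rewrite row_mx_tail.
split=> //.
- move=> f c Mc; pose t := tapp (fun j : 'I_(far f) => tvar L void (lift ord0 j)).
  pose phi := @fdist R L void _ (tvar L void ord0) t.
  have phiE x : feval setT (of_void C) phi (row_mx (const_mx x : 'rV_1) c) =
      mdist x (fint c).
    rewrite /= row_mx_head; congr (mdist _ (fint _)); apply/rowP => j.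
    by rewrite mxE row_mx_tail.
  rewrite (closure_id M).1// => U /nbhs_ballP[e /= e0 eU].
  have [|x Mx] := tv _ phi c e Mc.
    by apply/finf_lt => //; exists (fint c) => //; rewrite phiE mdistxx.
  by rewrite phiE => h; exists x; split=> //; apply: eU; rewrite ballEmdist /= mdistC.
- have finfE k (psi : formula R L void k.+1) c : tuples_in M c ->
      (forall c', tuples_in M c' ->
        feval M (of_void C) psi c' = feval setT (of_void C) psi c') ->
      feval M (of_void C) (finf psi) c = feval setT (of_void C) (finf psi) c.
    move=> Mc ih; have lt_eq r : (feval M (of_void C) (finf psi) c < r) =
        (feval setT (of_void C) (finf psi) c < r).
      apply/idP/idP => [/finf_lt[//|x Mx]|/tv[//|x Mx]].
        by rewrite ih; [move=> h; apply/finf_lt => //; exists x|exact: Mcons].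
      by rewrite -ih; [move=> h; apply/finf_lt => //; exists x|exact: Mcons].
    apply/eqP; rewrite eq_le !leNgt.
    by rewrite lt_eq ltxx /= -lt_eq ltxx.
  move=> k0 phi0; elim: phi0 => {k0} [k s t|k P ts|k m u cu ps ih|k psi ih|k psi ih] c Mc //.
  + by rewrite /=; congr u; apply/rowP => j; rewrite !mxE ih.
  + rewrite !fsupE; congr (- _); apply: finfE => // c' Mc'.
    by rewrite !feval_fneg ih.
  + exact: finfE.
Qed.

Let F := {k & formula R L void k}.

(** A Skolem function for each formula and each error 1/(i+1), since infima need not be attained. It
    takes an infinite sequence, of which the first [k] entries count, so all Skolem functions have
    the same arity and Skolem terms are trees branching over [nat]. *)
Let witness_ex (f : F) (s : nat -> C) (i : nat) : exists x : C,
  match f with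
  | existT k.+1 phi =>
    let c := (\row_(j < k) s j) in
    feval setT (of_void C) phi (row_mx (const_mx x : 'rV_1) c) <
    feval setT (of_void C) (finf phi) c + i.+1%:R^-1
  | _ => True
  end.
Proof.
have [x0] := car_inh C.
have T0 : [set: C] !=set0 by exists x0.
case: f => -[|k] phi; first by exists x0.
have [|x _ h] := (finf_lt (of_void C) phi (\row_j s j)
   (feval setT (of_void C) (finf phi) (\row_j s j) + i.+1%:R^-1) T0).1.
  by rewrite ltrDl invr_gt0.
by exists x.
Qed.

Let witness f s i : C := projT1 (cid (witness_ex f s i)).

Let witnessP k (phi : formula R L void k.+1) (s : nat -> C) (i : nat) (c := \row_(j < k) s j) :
  feval setT (of_void C) phi
    (row_mx (const_mx (witness (existT _ k.+1 phi) s i) : 'rV_1) c) <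
  feval setT (of_void C) (finf phi) c + i.+1%:R^-1.
Proof. exact: (projT2 (cid (witness_ex (existT _ k.+1 phi) s i))). Qed.

Lemma natSinv_lt (e : R) : 0 < e -> exists i : nat, i.+1%:R^-1 < e.
Proof.
move=> e0; have [i _ hi] := @near_infty_natSinv_lt R (PosNum e0).
by exists i; exact: (hi i (leqnn i)).
Qed.

(** A point of the closure is determined by the set of pairs of a point of [M] and a radius 1/(i+1)
    that exceeds its distance to that point. *)
Lemma small_closure (M : set C) : small M -> small (closure M).
Proof.
move=> /smallP sM; apply/smallP.
apply: (@small_type_embeds _ (set (M * nat))); last first.
  by apply: small_type_set => //; apply: small_type_prod => //; exact: small_type_nat.
exists (fun x => [set p | mdist (val x : C) (val p.1) < p.2.+1%:R^-1]).
move=> x y /seteqP[xy _]; apply: val_inj; apply: mdist_positivity.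
apply/eqP; rewrite eq_le mdist_ge0 andbT leNgt; apply/negP => d0.
have d20 : 0 < mdist (val x : C) (val y) / 2 by rewrite divr_gt0.
have [i hi] := natSinv_lt d20.
have [t [Mt]] : M `&` ball (val x : C) i.+1%:R^-1 !=set0.
  by apply: (set_valP x); apply: nbhsx_ballx; rewrite invr_gt0.
rewrite ballEmdist /= => xt; have := xy (SigSub (mem_set Mt), i) xt => /= yt.
have := metric_triangle (val x : C) t (val y); rewrite leNgt => /negP; apply.
rewrite [ltRHS]splitr; apply: ltrD; first exact: lt_trans hi.
by rewrite metric_sym; exact: lt_trans hi.
Qed.

Let car_ex : exists x : C, True.
Proof. by have [x] := car_inh C; exists x. Qed.

Let skolem_label (B : set C) : Type := B + (F * nat).

(** The value of a tree read as a Skolem term over [B]. Leaves labelled by a formula and nodes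
    labelled by a point of [B] get some value only to make the function total. *)
Fixpoint skolem (B : set C) (t : tree (skolem_label B)) : C :=
  match t with
  | Leaf (inl b) => val b
  | Leaf (inr (f, i)) => witness f (fun=> projT1 (cid car_ex)) i
  | Node (inl b) _ => val b
  | Node (inr (f, i)) s => witness f (fun j => skolem (s j)) i
  end.

Theorem loewenheim_skolem (B : set C) : small B -> exists2 M, model M & B `<=` M.
Proof.
move=> sB; have sX : small_ty (skolem_label B).
  apply: small_type_sum => //; first exact/smallP.
  apply: small_type_prod => //; last exact: small_type_nat.
  by apply: small_formulas; apply: small_type_count.
pose M0 := range (@skolem B).
have sM0 : small M0.
  by apply/smallP; apply: small_type_image; apply: small_type_tree.
have tv k (phi : formula R L void k.+1) c r : tuples_in M0 c ->
    feval setT (of_void C) (finf phi) c < r ->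
    exists2 x, M0 x &
      feval setT (of_void C) phi (row_mx (const_mx x : 'rV_1) c) < r.
  move=> Mc; rewrite -subr_gt0 => /natSinv_lt[i hi].
  have tP (j : 'I_k) : exists t, @skolem B t = c ord0 j by have [t _ <-] := Mc j; exists t.
  have [f fP] := choice tP.
  pose w : tree (skolem_label B) := Node (inr (existT _ k.+1 phi, i))
    (children (Leaf (inr (existT _ k.+1 phi, i))) f).
  exists (@skolem B w); first by exists w.
  have := witnessP phi (fun j => @skolem B (children (Leaf (inr (existT _ k.+1 phi, i))) f j)) i.
  have -> : \row_(j < k) @skolem B (children (Leaf (inr (existT _ k.+1 phi, i))) f j) = c.
    by apply/rowP => j; rewrite mxE /children valK fP.
  by move=> /lt_trans; apply; rewrite -ltrBrDl.
(* [B] may be empty; a point is then obtained from the test for the formula d(x, x), whose infimum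
   is 0. *)
have M00 : closure M0 !=set0.
  have [x] := car_inh C; pose phi := @fdist R L void 1 (tvar L void ord0) (tvar L void ord0).
  have [||y My _] := tv 0%N phi (\row_i x) 1.
  - by case.
  - by apply/finf_lt; [exists x|exists x => //=; rewrite mdistxx].
  by exists y; exact: subset_closure.
exists (closure M0); last first.
  by move=> b Bb; apply: subset_closure; exists (Leaf (inl (SigSub (mem_set Bb)))).
split; first exact: small_closure.
apply: tarski_vaught => //; first exact: closed_closure.
have T0 : [set: C] !=set0 by case: M00 => x _; exists x.
move=> k phi c r Mc /finf_lt[//|x _ hx].
(* The margin pays for two moves of the parameters: from [c] to the nearby [c0] in [M0], and back to
   [c] once the witness [y] is found. *)
pose eta := (r - feval setT (of_void C) phi (row_mx (const_mx x : 'rV_1) c)) / 3.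
have eta0 : 0 < eta by rewrite divr_gt0// subr_gt0.
have [d d0 hd] := feval_near (of_void C) phi T0 eta0.
have cP (j : 'I_k) : exists y, M0 y /\ mdist (c ord0 j) y < d.
  have [y [My]] := Mc j _ (nbhsx_ballx _ _ d0).
  by rewrite ballEmdist; exists y.
have [g gP] := choice cP; pose c0 := \row_j g j.
have cc0 : near_row d c c0 by move=> i; rewrite mxE; have [] := gP i.
have [||y My hy] := tv k phi c0 (r - eta).
- by move=> i; rewrite mxE; have [] := gP i.
- apply/finf_lt => //; exists x => //.
  have := hd _ _ (near_row_cons x d0 cc0); rewrite ltr_norml => /andP[h1 h2].
  by move: h1 h2 hx; rewrite /eta; lra.
exists y; first exact: subset_closure.
have := hd _ _ (near_row_cons y d0 cc0); rewrite ltr_norml => /andP[h1 h2].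
by move: h1 h2 hy; rewrite /eta; lra.
Qed.

End LoewenheimSkolem.

(** * Type spaces *)

Section Connectives.
Context (R : realType) (L : language) (C : structure R L) (A : Type).

Lemma continuous_bigmax m (T : topologicalType) (f : 'I_m -> T -> R) :
  (forall i, continuous (f i)) ->
  continuous (fun v => \big[Order.max/0]_(i < m) f i v).
Proof.
move=> cf v; elim: m f cf => [|m ih] f cf.
  rewrite (_ : (fun v => _) = fun=> 0); first exact: cst_continuous.
  by apply/funext => w; rewrite big_ord0.
rewrite (_ : (fun v => _) =
    (f ord0 \max (fun v => \big[Order.max/0]_(i < m) f (lift ord0 i) v))).
  by apply: continuous_max; [exact: cf|apply: ih => i; exact: cf].
by apply/funext => w; rewrite big_ord_recl.
Qed.

(** Serves as finite conjunction; the base value 0 of the maximum is harmless under bounds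
    [r > 0]. *)
Definition fmaxs k m (ps : 'I_m -> formula R L A k) : formula R L A k :=
  @fconn R L A k m (fun v => \big[Order.max/0]_(i < m) v ord0 i)
    (continuous_bigmax (fun i => @coord_continuous R 1 m ord0 i)) ps.

Lemma feval_fmaxs_lt X (e : A -> C) k m (ps : 'I_m -> formula R L A k) c r :
  0 < r -> feval X e (fmaxs ps) c < r <-> forall i, feval X e (ps i) c < r.
Proof.
move=> r0 /=; split=> [h i|h].
  by apply: le_lt_trans h; have := le_bigmax 0 (fun i => (\row_j feval X e (ps j) c) ord0 i) i;
    rewrite mxE.
by apply: (big_ind (fun x => x < r)) => // [x y xr yr|i _];
  [rewrite gt_max xr|rewrite mxE].
Qed.

Lemma coord_comp_continuous (u : R -> R) : continuous u ->
  continuous (fun v : 'rV[R]_1 => u (v ord0 ord0)).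
Proof.
by move=> cu v; apply: continuous_comp; [exact: coord_continuous|exact: cu].
Qed.

Definition fapp (u : R -> R) (cu : continuous u) k (phi : formula R L A k) :
    formula R L A k :=
  @fconn R L A k 1 (fun v => u (v ord0 ord0)) (coord_comp_continuous cu) (fun=> phi).

Lemma feval_fapp X (e : A -> C) u (cu : continuous u) k (phi : formula R L A k) c :
  feval X e (fapp cu phi) c = u (feval X e phi c).
Proof. by rewrite /= mxE. Qed.

Lemma dist_to_continuous (r s : R) : continuous (fun x : R => `|x - r| / s).
Proof.
move=> x; apply: cvgMl; apply: cvg_norm; apply: cvgB; [exact: cvg_id|exact: cvg_cst].
Qed.

(** The deviation from [r] in units of [s], which brings a condition of closeness to [r] into the
    normal form [< 1]. *)
Definition fdev (r s : R) k (phi : formula R L A k) : formula R L A k :=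
  fapp (@dist_to_continuous r s) phi.

Lemma feval_fdev X (e : A -> C) r s k (phi : formula R L A k) c :
  feval X e (fdev r s phi) c = `|feval X e phi c - r| / s.
Proof. exact: feval_fapp. Qed.

End Connectives.

Lemma ptws_cvgP (I : Type) (T : topologicalType) (F : set_system {ptws I -> T})
    (f : {ptws I -> T}) : Filter F ->
  F --> f <-> forall i, (fun g : {ptws I -> T} => g i) @ F --> f i.
Proof.
move=> FF; split=> [/cvg_sup Ff i U|h].
  rewrite nbhsE => -[B [oB Bf] BU]; apply: filterS BU _; apply: (Ff i).
  by apply: open_nbhs_nbhs; split; first by exists B.
apply/cvg_sup => i U [_ [[B oB <-] Bf] BU].
by apply: filterS BU _; apply: (h i); exact: open_nbhs_nbhs.
Qed.

Section TypeSpace.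
Context (R : realType) (L : language) (C : monster R L) (n : nat).
Implicit Types (A B : set C).

Definition tev A (phi : formula R L A n) (p : tspace n A) : R := set_val p phi.

Lemma tspace_inh A (p : tspace n A) : exists c, p = tp A c.
Proof.
have [c _ pE] := set_valP p; exists c; apply/val_inj.
by rewrite -[LHS]pE.
Qed.

Lemma tev_tp A phi c : tev phi (tp A c) = feval setT set_val phi c.
Proof. by []. Qed.

Lemma tp_eqP A (a b : 'rV[C]_n) : tp A a = tp A b <->
  forall phi : formula R L A n, feval setT set_val phi a = feval setT set_val phi b.
Proof.
split=> [e phi|h]; first by rewrite -!tev_tp e.
by apply/val_inj/funext => phi; exact: h.
Qed.

Lemma tev_inj A (p q : tspace n A) : (forall phi, tev phi p = tev phi q) -> p = q.
Proof. by move=> h; apply/val_inj/funext => phi; exact: h. Qed.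

Lemma monster_inh : [set: C] !=set0.
Proof. by have [x] := car_inh C; exists x. Qed.

Lemma tev_fdev A r s (phi : formula R L A n) p :
  tev (fdev r s phi) p = `|tev phi p - r| / s.
Proof. by have [c ->] := tspace_inh p; rewrite !tev_tp feval_fdev. Qed.

Lemma tev_fmaxs_lt A m (ps : 'I_m -> formula R L A n) p r : 0 < r ->
  tev (fmaxs ps) p < r <-> forall i, tev (ps i) p < r.
Proof. by have [c ->] := tspace_inh p => r0; rewrite tev_tp feval_fmaxs_lt. Qed.

(** A normal form of neighbourhoods with a single formula. The sets [tev phi < 1] with
    [tev phi p = 0] form a filter base thanks to [fmaxs], and thanks to [fdev] this filter converges
    to [p] pointwise on formulas. *)
Lemma tspace_nbhs A (p : tspace n A) (U : set (tspace n A)) : nbhs p U ->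
  exists2 phi : formula R L A n, tev phi p = 0 & forall q, tev phi q < 1 -> U q.
Proof.
move=> [_ [[B oB <-] Bp] BU].
pose D := [set phi : formula R L A n | tev phi p = 0].
pose G : set_system (tspace n A) := filter_from D (fun phi => [set q | tev phi q < 1]).
have GF : Filter G.
  apply: filter_from_filter.
    have [x _] := monster_inh.
    (* The empty maximum is the constant formula 0. *)
    pose phi : formula R L A n :=
      fmaxs (fun i : 'I_0 => match i with Ordinal _ h => match notF h with end end).
    exists phi; rewrite /D /=; have [c ->] := tspace_inh p.
    by rewrite tev_tp /= big_ord0.
  move=> phi psi phip psip; exists (fmaxs (fun i : 'I_2 => if i == ord0 then phi else psi)).
    rewrite /D /=; have [c pE] := tspace_inh p; rewrite pE tev_tp /= !big_ord_recl big_ord0 !mxE /=.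
    by rewrite -!tev_tp -pE phip psip !maxxx.
  by move=> q /= /tev_fmaxs_lt h; split; [exact: (h ltr01 ord0)|exact: (h ltr01 ord_max)].
have : {ptws, (set_val @ G) --> (set_val p : {ptws formula R L A n -> R})}.
  apply/ptws_cvgP => phi; apply/cvgrPdist_lt => e e0.
  exists (fdev (tev phi p) e phi).
    by rewrite /D /= tev_fdev subrr normr0 mul0r.
  move=> q /=; rewrite tev_fdev ltr_pdivrMr// mul1r distrC; exact.
move=> /(_ B)[|phi phip h]; first exact: open_nbhs_nbhs.
by exists phi => // q hq; apply: BU; exact: h.
Qed.

Lemma tev_continuous A (phi : formula R L A n) : continuous (tev phi).
Proof.
move=> p U hU.
have hc : continuous (set_val : tspace n A -> {ptws formula R L A n -> R}).
  exact: initial_continuous.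
have := (ptws_cvgP (set_val p) _).1 (hc p) phi U hU.
by move=> h; refine (h _); apply: fmap_filter; exact: nbhs_filter.
Qed.

Lemma tspace_hausdorff A : hausdorff_space (tspace n A).
Proof.
move=> p q pq; apply: tev_inj => phi; apply/eqP; rewrite -subr_eq0 -normr_le0.
rewrite leNgt; apply/negP => d0.
pose d := `|tev phi p - tev phi q| / 2.
have nb r : nbhs r [set s | `|tev phi s - tev phi r| < d].
  have /cvgrPdist_lt/(_ d) := @tev_continuous A phi r.
  rewrite divr_gt0// => /(_ isT); apply: filterS => s /=; by rewrite distrC.
have [s [/= h1 h2]] := pq _ _ (nb p) (nb q).
have := ler_distD (tev phi s) (tev phi p) (tev phi q); rewrite leNgt => /negP; apply.
by rewrite [ltRHS]splitr ltrD// distrC.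
Qed.

Lemma filter_seq T (U : eqType) (F : set_system T) (P : U -> T -> Prop) (s : seq U) :
  Filter F -> (forall x, x \in s -> F (P x)) -> F [set t | forall x, x \in s -> P x t].
Proof.
move=> FF; elim: s => [|x s ih] h; first by apply: filterS filterT.
have h1 := h x (mem_head _ _).
have h2 : F [set t | forall y, y \in s -> P y t].
  by apply: ih => y ys; apply: h; rewrite inE ys orbT.
apply: filterS2 h1 h2 => t h1 h2 y; rewrite inE => /orP[/eqP ->//|]; exact: h2.
Qed.

(** Compactness is saturation: along an ultrafilter every formula, being bounded, has a limit value;
    the conditions prescribing these values are finitely satisfiable, and the type of a realization
    is the limit. *)
Lemma tspace_compact A : small A -> compact [set: tspace n A].
Proof.
move=> sA; rewrite compact_ultra => F FU _.
have FF : ProperFilter F by exact: ultra_proper.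
have lim (phi : formula R L A n) : exists r : R, tev phi @ F --> r.
  have [b hb] := feval_bounded C phi.
  have cpt : compact `[- b, b]%classic by exact: segment_compact.
  have [|r [_ clr]] := cpt (tev phi @ F) _.
    have tb (p : tspace n A) : tev phi p \in `[- b, b].
      have [c ->] := tspace_inh p.
      by rewrite tev_tp in_itv /= -ler_norml hb//; exact: monster_inh.
    by apply: (@filterS _ F _ setT) => [p _|]; [exact: tb|exact: filterT].
  exists r => U rU; have [//|FC] := in_ultra_setVsetC (tev phi @^-1` U) FU.
  by have [y [/= nUy Uy]] := clr (~` U) U FC rU.
have [g gP] := choice lim.
have nearg (phi : formula R L A n) e : 0 < e -> F [set p | `|tev phi p - g phi| < e].
  move=> e0; have /cvgrPdist_lt/(_ e e0) := gP phi.
  by apply: filterS => p /=; rewrite distrC.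
pose Gam := range (fun phi : formula R L A n => fdev (g phi) 1 phi).
have [|c hc] := monster_saturated (monsterP C) (Gamma := Gam) sA.
  move=> G fG sub e e0; have /(@finite_seqP {classic formula R L A n})[s sE] := fG.
  have : F [set p | forall x : {classic formula R L A n}, x \in s -> `|tev x p| < e].
    apply: filter_seq => x xs; have [|phi _ <-] := sub x; first by rewrite sE.
    apply: filterS (nearg phi e e0) => p /=.
    by rewrite tev_fdev divr1 normr_id.
  move=> /filter_ex[p hp]; have [c pE] := tspace_inh p; exists c => phi Gphi.
  by rewrite -tev_tp -pE; apply: hp; rewrite sE in Gphi.
exists (tp A c); split=> // U /tspace_nbhs[phi phi0 phiU].
have gE : g phi = 0.
  have := hc (fdev (g phi) 1 phi); rewrite feval_fdev -tev_tp phi0 sub0r normrN divr1.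
  by move=> h; apply/eqP; rewrite -normr_eq0 h//; exists phi.
have := nearg phi 1 ltr01; apply: filterS => p /=; rewrite gE subr0 => hp.
by apply: phiU; exact: le_lt_trans (ler_norm _) hp.
Qed.

End TypeSpace.

(** * Distances between types *)

Section TupleDistance.
Context (R : realType) (L : language) (C : monster R L) (n : nat).
Implicit Types a b c : 'rV[C]_n.

Lemma tdist_lt a b e : 0 < e -> tdist a b < e <-> near_row e a b.
Proof.
move=> e0; rewrite /tdist; split=> [h i|h].
  by apply: le_lt_trans h; exact: (le_bigmax 0 (fun i => mdist (a ord0 i) (b ord0 i))).
by apply: (big_ind (fun x => x < e)) => // x y xe ye; rewrite gt_max xe.
Qed.

Lemma tdist_ge0 a b : 0 <= tdist a b.
Proof. exact: bigmax_ge_id. Qed.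

Lemma tdistC a b : tdist a b = tdist b a.
Proof. by rewrite /tdist; apply: eq_bigr => i _; rewrite mdistC. Qed.

Lemma tdist_triangle b a c : tdist a c <= tdist a b + tdist b c.
Proof.
rewrite {1}/tdist; apply: (big_ind (fun x => x <= tdist a b + tdist b c)) => [|x y hx hy|i _].
- by rewrite addr_ge0// tdist_ge0.
- by rewrite ge_max hx.
apply: le_trans (metric_triangle _ (b ord0 i) _) _; apply: lerD.
  exact: (le_bigmax 0 (fun i => mdist (a ord0 i) (b ord0 i))).
exact: (le_bigmax 0 (fun i => mdist (b ord0 i) (c ord0 i))).
Qed.

Lemma tdistxx a : tdist a a = 0.
Proof.
apply/eqP; rewrite eq_le tdist_ge0 andbT; apply/ler_addgt0Pl => e e0.
by rewrite addr0 ltW//; apply/tdist_lt => // i; rewrite mdistxx.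
Qed.

Lemma tdist_ball a b e : 0 < e -> ball a e b <-> tdist a b < e.
Proof. by move=> e0; rewrite tdist_lt// near_row_ball. Qed.

Lemma tdist_bounded : exists2 b : R, 0 < b & forall a c, tdist a c < b.
Proof.
have [b hb] := car_bounded C; exists (`|b| + 1); first by rewrite ltr_wpDl.
move=> a c; apply/tdist_lt; first by rewrite ltr_wpDl.
by move=> i; rewrite (le_lt_trans (hb _ _))// (le_lt_trans (ler_norm _))// ltrDl.
Qed.

Lemma feval_tdist (A : Type) (e : A -> C) X (phi : formula R L A n) : X !=set0 ->
  forall eps, 0 < eps -> exists2 d, 0 < d & forall a b,
    tdist a b < d -> `|feval X e phi a - feval X e phi b| < eps.
Proof.
move=> X0 eps eps0; have [d d0 h] := feval_near e phi X0 eps0.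
by exists d => // a b /(tdist_lt _ _ d0); exact: h.
Qed.

End TupleDistance.

(** * Automorphisms and realizations of types at given distances *)

Section Homogeneity.
Context (R : realType) (L : language) (C : monster R L).
Implicit Types (A B M : set C) (n : nat).

Lemma automorphism_teval (A : Type) (e : A -> C) s k (t : term L A k) c :
  automorphism s -> s (teval e t c) = teval (s \o e) t (map_mx s c).
Proof.
move=> [_ _ sf _]; elim: t => //= [i|f ts ih]; first by rewrite mxE.
by rewrite sf; congr fint; apply/rowP => j; rewrite !mxE ih.
Qed.

Lemma automorphism_feval (A : Type) (e : A -> C) s k (phi : formula R L A k) c :
  automorphism s -> feval setT (s \o e) phi (map_mx s c) = feval setT e phi c.
Proof.
move=> as_; have [[t st ts] sd _ sp] := as_.
have cons j (x : C) (v : 'rV[C]_j) :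
    row_mx (const_mx (s x) : 'rV_1) (map_mx s v) = map_mx s (row_mx (const_mx x : 'rV_1) v).
  by rewrite map_row_mx map_const_mx.
elim: phi c => /= {k} [k u v|k P us|k m u cu ps ih|k psi ih|k psi ih] c.
- by rewrite -!automorphism_teval.
- rewrite -[RHS]sp; congr pint; apply/rowP => j.
  by rewrite !mxE automorphism_teval.
- by congr u; apply/rowP => j; rewrite !mxE ih.
- congr sup; apply/seteqP; split=> _ [x _ <-].
    by exists (t x) => //; rewrite -ih -cons ts.
  by exists (s x) => //; rewrite cons ih.
- congr inf; apply/seteqP; split=> _ [x _ <-].
    by exists (t x) => //; rewrite -ih -cons ts.
  by exists (s x) => //; rewrite cons ih.
Qed.

Lemma automorphism_tp n A s (c : 'rV[C]_n) : automorphism s ->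
  (forall a, A a -> s a = a) -> tp A (map_mx s c) = tp A c.
Proof.
move=> as_ sA; apply/tp_eqP => phi; rewrite -[RHS](automorphism_feval _ _ _ as_).
by apply: eq_feval_env => a /=; rewrite sA//; exact: set_valP.
Qed.

Lemma automorphism_tdist n s (a b : 'rV[C]_n) : automorphism s ->
  tdist (map_mx s a) (map_mx s b) = tdist a b.
Proof. by move=> [_ sd _ _]; apply: eq_bigr => i _; rewrite !mxE sd. Qed.

Lemma small_coords n A (c : 'rV[C]_n) : small A ->
  small (A `|` range (c ord0)).
Proof.
move=> /smallP sA; apply/smallP.
have unc := monster_uncountable (monsterP C).
have slim := monster_strong_limit (monsterP C).
by apply: small_type_setU => //; apply: small_type_image; exact: small_type_count.
Qed.

(** The map fixing [A] and sending the coordinates of [a] to those of [c] is well defined and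
    elementary: each point of its domain is the value at [a] of a parameter or a variable, so that
    after substitution a statement about such points is one about the tuple [a]. *)
Lemma homogeneity n A (a c : 'rV[C]_n) : small A -> tp A a = tp A c ->
  exists s, [/\ automorphism s, forall x, A x -> s x = x & map_mx s a = c].
Proof.
move=> sA /tp_eqP ac.
pose isval x (t : term L A n) := teval set_val t a = x /\
  ((exists y, t = tpar L n y) \/ exists i, t = tvar L A i).
have eqv x t u : isval x t -> isval x u -> teval set_val t c = teval set_val u c.
  move=> [tx _] [ux _]; apply: mdist_positivity.
  by have /= <- := ac (fdist R t u); rewrite tx ux mdistxx.
pose f x := if pselect (exists t, isval x t) is left h then teval set_val (projT1 (cid h)) c else x.
have fE x t : isval x t -> f x = teval set_val t c.
  move=> xt; rewrite /f; case: pselect => [h|[]]; last by exists t.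
  by apply: eqv xt; exact: (projT2 (cid h)).
have D x : (A `|` range (a ord0)) x -> exists t, isval x t.
  move=> [Ax|[i _ <-]].
    by exists (tpar L n (SigSub (mem_set Ax))); split=> //; left; eexists.
  by exists (tvar L A i); split=> //; right; eexists.
have [||s as_ sE] := monster_homogeneous (monsterP C) (A := A `|` range (a ord0)) (f := f).
- exact: small_coords.
- move=> k phi t Dt; have /choice[u uP] : forall j, exists u, isval (t ord0 j) u.
    by move=> j; apply: D; exact: Dt.
  have := ac (fsubst phi (fun v : void => match v with end) u); rewrite !feval_subst.
  have V (e : void -> C) : e = of_void C by apply/funext => -[].
  rewrite [X in feval _ X _ _ = _]V [X in _ = feval _ X _ _]V => h.
  transitivity (feval setT (of_void C) phi (\row_j teval set_val (u j) c)).
    by congr (feval _ _ _ _); apply/rowP => j; rewrite !mxE; exact: fE.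
  transitivity (feval setT (of_void C) phi (\row_j teval set_val (u j) a)).
    exact: esym h.
  by congr (feval _ _ _ _); apply/rowP => j; rewrite mxE; have [] := uP j.
exists s; split=> //.
  move=> x Ax; rewrite sE; last by left.
  by rewrite (fE _ (tpar L n (SigSub (mem_set Ax)))); [|split=> //; left; eexists].
apply/rowP => i; rewrite mxE sE; last by right; exists i.
by rewrite (fE _ (tvar L A i)); [|split=> //; right; eexists].
Qed.

(** Homogeneity moves any pair of realizations so that the first becomes the given [a]; this reduces
    all later distances between types to distances from one fixed tuple. *)
Lemma dtp_lt n A (a : 'rV[C]_n) (q : tspace n A) e : small A ->
  dtp (tp A a) q < e <-> exists2 b, tp A b = q & tdist a b < e.
Proof.
move=> sA; have [b0 qE] := tspace_inh q.
pose S : set R := [set tdist a b | a in [set a' | tp A a' = tp A a] & b in [set b | tp A b = q]].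
have S0 : S !=set0 by exists (tdist a b0); exists a => //; exists b0 => //=; rewrite qE.
have Slb : has_lbound S by exists 0 => _ [x _ [y _ <-]]; exact: tdist_ge0.
split=> [/(inf_lt S0)[_ [a' /= aa' [b /= bq <-]]] h|[b bq h]]; last first.
  by apply: le_lt_trans h; apply: ge_inf => //; exists a => //; exists b.
have [s [as_ sA' <-]] := homogeneity sA aa'.
exists (map_mx s b); first by rewrite automorphism_tp.
by rewrite automorphism_tdist.
Qed.

Lemma dtp_set_lt n A (a : 'rV[C]_n) (Q : set (tspace n A)) e : small A ->
  (dtp_set (tp A a) Q < e%:E)%E <-> exists2 b, Q (tp A b) & tdist a b < e.
Proof.
move=> sA; split=> [/ereal_inf_lt[_ [p Qp <-]]|[b Qb h]].
  by rewrite lte_fin => /(dtp_lt _ _ _ sA)[b bp h]; exists b => //; rewrite bp.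
apply: le_lt_trans (_ : (dtp (tp A a) (tp A b))%:E < e%:E)%E.
  by apply: ereal_inf_lbound; exists (tp A b).
by rewrite lte_fin; apply/dtp_lt => //; exists b.
Qed.

Lemma thickenP n A (a : 'rV[C]_n) (Q : set (tspace n A)) e : small A ->
  thicken Q e (tp A a) <-> exists2 b, Q (tp A b) & tdist a b < e.
Proof. exact: dtp_set_lt. Qed.

Lemma small_sub A B : A `<=` B -> small B -> small A.
Proof.
move=> AB /smallP sB; apply/smallP; apply: small_type_embeds sB.
by apply/card_le_embeds/subset_card_le.
Qed.

Lemma tp_restr_eq n A B (AB : A `<=` B) (a c : 'rV[C]_n) :
  tp B a = tp B c -> tp A a = tp A c.
Proof. by move=> e; rewrite -!(restr_tp AB) e. Qed.

Lemma tp_self n A (a c : 'rV[C]_n) : tuples_in A a -> tp A a = tp A c -> a = c.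
Proof.
move=> Aa /tp_eqP ac; apply/rowP => i; apply: mdist_positivity.
have := ac (fdist R (tpar L n (SigSub (mem_set (Aa i)))) (tvar L A i)).
by rewrite /= mdistxx.
Qed.

(** A tuple of [M] is the only realization of its type over [M], so the distance of a type over [M]
    to [M] is measured from a realization to actual tuples. *)
Lemma lt_algebraicP n A e (a : 'rV[C]_n) : small A ->
  lt_algebraic e (tp A a) <-> forall M, model M -> A `<=` M ->
    forall c, tp A c = tp A a -> exists2 m, tuples_in M m & tdist c m < e.
Proof.
move=> sA; split=> [h M mM AM c ca|h M AM mM q qa].
  have := h M AM mM (tp M c); rewrite restr_tp ca => /(_ erefl).
  move=> /(dtp_set_lt _ _ _ mM.1)[b [m Mm /(tp_self Mm) <-]] cb.
  by exists m.
have [c qE] := tspace_inh q; rewrite qE restr_tp in qa *.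
have [m Mm cm] := h M mM AM c qa; apply/(dtp_set_lt _ _ _ mM.1).
by exists m => //; exists m.
Qed.

Lemma restr_continuous n A B (AB : A `<=` B) : continuous (@restr R L C n A B AB).
Proof.
move=> q U /tspace_nbhs[phi phi0 phiU].
have E r : tev phi (restr AB r) = tev (frename (par_incl AB) phi) r by [].
have : nbhs q (tev (frename (par_incl AB) phi) @^-1` [set x | x < 1]).
  apply: tev_continuous; apply: open_nbhs_nbhs; split; first exact: open_lt.
  by rewrite /= -E phi0.
by apply: filterS => r /= h; apply: phiU; rewrite E.
Qed.

Lemma tp_continuous n A : continuous (@tp R L C n A).
Proof.
move=> c U /tspace_nbhs[phi phi0 phiU].
have [d d0 h] := feval_tdist set_val phi (monster_inh C) ltr01.
apply/nbhs_ballP; exists d => // c' /(tdist_ball _ _ d0) cc'; apply: phiU.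
have := h _ _ cc'; rewrite -!tev_tp phi0 sub0r normrN.
exact: le_lt_trans (ler_norm _).
Qed.

End Homogeneity.

(** * Models in type spaces *)

Section FiniteSupport.
Context (R : realType) (L : language) (C : structure R L) (A : eqType).

Lemma teval_support k (t : term L A k) : exists s : seq A,
  forall (e e' : A -> C), {in s, e =1 e'} -> forall c, teval e t c = teval e' t c.
Proof.
elim: t => [i|a|f ts ih].
- by exists [::].
- by exists [:: a] => e e' h c /=; apply: h; rewrite mem_head.
have [s sP] := choice ih; exists (flatten [seq s i | i <- enum 'I_(far f)]).
move=> e e' h c /=; congr fint; apply/rowP => j; rewrite !mxE; apply: sP => a aj.
by apply: h; apply/flattenP; exists (s j) => //; apply: map_f; rewrite mem_enum.
Qed.

Lemma feval_support k (phi : formula R L A k) : exists s : seq A,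
  forall (X : set C) (e e' : A -> C), {in s, e =1 e'} ->
    forall c, feval X e phi c = feval X e' phi c.
Proof.
elim: phi => {k} [k u v|k P ts|k m u cu ps ih|k psi [s ih]|k psi [s ih]].
- have [s1 h1] := teval_support u; have [s2 h2] := teval_support v.
  exists (s1 ++ s2) => X e e' h c /=; rewrite (h1 e e') ?(h2 e e') // => a ai;
    by apply: h; rewrite mem_cat ai ?orbT.
- have [s sP] := choice (fun j => teval_support (ts j)).
  exists (flatten [seq s i | i <- enum 'I_(par P)]).
  move=> X e e' h c /=; congr pint; apply/rowP => j; rewrite !mxE; apply: sP => a aj.
  by apply: h; apply/flattenP; exists (s j) => //; apply: map_f; rewrite mem_enum.
- have [s sP] := choice ih.
  exists (flatten [seq s i | i <- enum 'I_m]).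
  move=> X e e' h c /=; congr u; apply/rowP => j; rewrite !mxE; apply: sP => a aj.
  by apply: h; apply/flattenP; exists (s j) => //; apply: map_f; rewrite mem_enum.
- exists s => X e e' h c /=; congr sup; apply: eq_imagel => x _; exact: ih.
- exists s => X e e' h c /=; congr inf; apply: eq_imagel => x _; exact: ih.
Qed.

End FiniteSupport.

Section Models.
Context (R : realType) (L : language) (C : monster R L).
Implicit Types (A B M : set C) (n : nat).

(** Elementarity concerns formulas without parameters, so the finitely many parameters of [phi]
    become the last variables of [psi], and the first [n] variables are bound by infima. *)
Lemma model_dense M n (phi : formula R L M n) (b : 'rV[C]_n) r : model M ->
  feval setT set_val phi b < r ->
  exists2 m, tuples_in M m & feval setT set_val phi m < r.
Proof.
move=> [_ [[x0 Mx0] _ _ elem]] phib.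
pose n0 : M := SigSub (mem_set Mx0).
have [s sP] := @feval_support R L C M n phi.
(* The additional coordinate provides the successor bound that [inord] requires. *)
pose k := (size s).+1; pose a := \row_(j < k) (val (nth n0 s j) : C).
pose psi : formula R L void (n + k) := fsubst phi
  (fun x => tvar L void (rshift n (inord (index x s) : 'I_k))) (fun i => tvar L void (lshift k i)).
have psiE X c : feval X (of_void C) psi (row_mx c a) = feval X set_val phi c.
  rewrite feval_subst.
  have -> : \row_j teval (of_void C) (tvar L void (lshift k j)) (row_mx c a) = c.
    by apply/rowP => j; rewrite mxE /= row_mxEl.
  apply: sP => x xs /=; rewrite row_mxEr mxE inordK ?nth_index//.
  by rewrite ltnS ltnW// index_mem.
have Ma : tuples_in M a by move=> i; rewrite mxE; exact: set_valP.
have : feval M (of_void C) (finfs psi) a < r.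
  by rewrite elem//; apply/finfs_lt; [exact: monster_inh|exists b; rewrite ?psiE].
move=> /finfs_lt[|m Mm]; first by exists x0.
by rewrite elem ?psiE; [exists m|move=> i; case: (split_ordP i) => j ->;
  rewrite ?row_mxEl ?row_mxEr; [exact: Mm|exact: Ma]].
Qed.

(** The closure [X] of the types over [B] of tuples of [M] is compact, so its restriction to [M] is
    closed; by density of [M] it meets every neighbourhood of [tp M m]. That the type of [c] lies in
    [X] is then used as the persistence at [c] of lower bounds valid on [M]. *)
Lemma coheir M B n (m : 'rV[C]_n) : model M -> small B -> M `<=` B ->
  exists2 c, tp M c = tp M m & forall (phi : formula R L B n) r,
    (forall m', tuples_in M m' -> r <= feval setT set_val phi m') ->
    r <= feval setT set_val phi c.
Proof.
move=> mM sB MB; pose X := closure [set tp B m' | m' in tuples_in M (k := n)].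
have cX : compact X.
  apply: subclosed_compact; [exact: closed_closure|exact: (@tspace_compact R L C n B sB)|by []].
have clX : closed (restr MB @` X).
  apply: compact_closed; first exact: tspace_hausdorff.
  by apply: continuous_compact => //; apply: continuous_subspaceT; exact: restr_continuous.
have [q Xq qm] : (restr MB @` X) (tp M m).
  apply: contrapT => nX.
  have /tspace_nbhs[phi phi0 phiU] : nbhs (tp M m) (~` (restr MB @` X)).
    by apply: open_nbhs_nbhs; split => //; exact: closed_openC.
  have [|m' Mm' hm'] := @model_dense M n phi m 1 mM; first by rewrite -tev_tp phi0.
  apply: (phiU (tp M m')) => //; exists (tp B m'); last exact: restr_tp.
  by apply: subset_closure; exists m'.
have [c qE] := tspace_inh q; exists c; first by rewrite -qm qE restr_tp.
move=> phi r h; rewrite -tev_tp -qE.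
have cl : closed (tev phi @^-1` [set x | r <= x]).
  by apply: closed_comp => [p _|]; [exact: tev_continuous|exact: closed_ge].
suff : X `<=` tev phi @^-1` [set x | r <= x] by apply.
rewrite /X [Y in _ `<=` Y](closure_id _).1//; apply: closureS => _ [m' Mm' <-].
exact: h.
Qed.

Lemma closed_metric n A (X : set (tspace n A)) (c : 'rV[C]_n) : closed X ->
  (forall e, 0 < e -> exists2 b, X (tp A b) & tdist c b < e) -> X (tp A c).
Proof.
move=> clX h; apply: clX => U /tp_continuous/nbhs_ballP[e /= e0 eU].
have [b Xb cb] := h e e0; exists (tp A b); split=> //; apply: eU.
exact/tdist_ball.
Qed.

(** Near each type a syntactic formula controls the oscillation of [P], and syntactic formulas are
    uniformly continuous in the tuple; compactness makes the resulting radius uniform. *)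
Lemma continuous_metric n A (P : tspace n A -> R) : small A -> continuous P ->
  forall e, 0 < e -> exists2 d, 0 < d & forall a b, tdist a b < d ->
    `|P (tp A a) - P (tp A b)| < e.
Proof.
move=> sA cP e e0.
have /compact_near_coveringP nc := @tspace_compact R L C n A sA.
have [|d /= d0 hd] := nc R (0^'+)
   (fun d p => forall a b, tp A a = p -> tdist a b < d -> `|P p - P (tp A b)| < e) _.
  move=> p _.
  have /tspace_nbhs[phi phi0 phiU] : nbhs p [set q | `|P q - P p| < e / 2].
    have /cvgrPdist_lt/(_ (e / 2)) := cP p; rewrite divr_gt0// => /(_ isT).
    by apply: filterS => q /=; rewrite distrC.
  have h20 : 0 < 1 / 2 :> R by rewrite divr_gt0.
  have [d d0 hd] := feval_tdist set_val phi (monster_inh C) h20.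
  exists ([set q | tev phi q < 1 / 2], [set d' | d' < d]) => /=.
    split; last exact: nbhs_right_lt.
    have : nbhs p (tev phi @^-1` [set x | x < 1 / 2]); last by [].
    apply: tev_continuous; apply: open_nbhs_nbhs; split; first exact: open_lt.
    by rewrite /= phi0.
  move=> [q d'] /= [hq hd'] a b aq ab; have := hd _ _ (lt_trans ab hd').
  rewrite -!tev_tp aq ltr_norml => /andP[h1 h2].
  have : `|P q - P p| < e / 2 by apply: phiU; lra.
  have : `|P (tp A b) - P p| < e / 2 by apply: phiU; lra.
  by move=> hb ha; rewrite [e]splitr (le_lt_trans (ler_distD (P p) _ _))// ltrD// distrC.
have d20 : 0 < d / 2 by rewrite divr_gt0.
exists (d / 2) => // a b ab; apply: (hd (d / 2)) ab => //=.
by rewrite sub0r normrN gtr0_norm// ltr_pdivrMr// ltr_pMr// ltr1n.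
Qed.

(** That some [y] within [e] of [x] satisfies the open condition is a strict bound on an infimum
    over [y], hence open in [x]. *)
Lemma thicken_open n A (U : set (tspace n A)) e : small A -> 0 < e -> open U ->
  open (thicken U e).
Proof.
move=> sA e0 oU; rewrite openE => p; have [a ->] := tspace_inh p.
move=> /(thickenP _ _ _ sA)[b Ub ab].
have /tspace_nbhs[phi phi0 phiU] : nbhs (tp A b) U by exact: open_nbhs_nbhs.
pose psi : formula R L A (n + n) := fmaxs (fun i : 'I_2 => if i == ord0 then
    fsubst phi (fun x => tpar L _ x) (fun i => tvar L A (lshift n i))
  else fmaxs (fun j => fdev 0 e (fdist R (tvar L A (lshift n j)) (tvar L A (rshift n j))))).
have psiP y x : feval setT set_val psi (row_mx y x) < 1 <->
    feval setT set_val phi y < 1 /\ tdist x y < e.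
  rewrite feval_fmaxs_lt//.
  have E0 : feval setT set_val (fsubst phi (fun x => tpar L _ x) (fun i => tvar L A (lshift n i)))
     (row_mx y x) = feval setT set_val phi y.
    by rewrite feval_subst; congr (feval _ _ _ _); apply/rowP => j; rewrite mxE /= row_mxEl.
  have E1 : feval setT set_val
     (fmaxs (fun j => fdev 0 e (fdist R (tvar L A (lshift n j)) (tvar L A (rshift n j)))))
     (row_mx y x) < 1 <-> tdist x y < e.
    rewrite feval_fmaxs_lt// tdist_lt//; split=> h i; have := h i;
      by rewrite feval_fdev /= row_mxEl row_mxEr subr0 ger0_norm ?mdist_ge0//
        ltr_pdivrMr// mul1r mdistC.
  split=> [h|[h1 h2] i].
    by split; [rewrite -E0; exact: (h ord0)|apply/E1; exact: (h ord_max)].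
  by case: ifP => _; [rewrite E0|apply/E1].
have chiP x : tev (finfs psi) (tp A x) < 1 <->
    exists2 y, feval setT set_val phi y < 1 & tdist x y < e.
  rewrite tev_tp finfs_lt; last exact: monster_inh.
  split=> [[y _ /psiP[]]|[y h1 h2]]; first by exists y.
  by exists y => //; apply/psiP.
have : nbhs (tp A a) (tev (finfs psi) @^-1` [set x | x < 1]).
  apply: tev_continuous; apply: open_nbhs_nbhs; split; first exact: open_lt.
  by apply/chiP; exists b => //; rewrite -tev_tp phi0.
apply: filterS => q; have [x ->] := tspace_inh q; move=> /chiP[y hy xy].
by apply/thickenP => //; exists y => //; apply: phiU.
Qed.

Lemma half_lt (e d : R) : 0 < d -> exists j : nat, e / 2 ^+ j < d.
Proof.
move=> d0; have [e0|e0] := leP e 0.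
  by exists 0%N; rewrite expr0 divr1 (le_lt_trans e0).
have [i hi] := natSinv_lt (divr_gt0 d0 e0); exists i.
rewrite mulrC -ltr_pdivlMr//; apply: le_lt_trans hi.
rewrite lef_pV2 ?posrE ?exprn_gt0// -natrX ler_nat.
by rewrite ltn_expl.
Qed.

Lemma tdist_cauchy n (x : nat -> 'rV[C]_n) (e : R) :
  (forall j, tdist (x j) (x j.+1) <= e / 2 ^+ j.+1) ->
  exists l, forall j, tdist (x j) l <= e / 2 ^+ j.
Proof.
move=> h.
have dist_ i j : tdist (x i) (x (i + j)%N) <= e / 2 ^+ i - e / 2 ^+ (i + j).
  elim: j => [|j ih]; first by rewrite addn0 tdistxx subrr.
  rewrite addnS; apply: le_trans (tdist_triangle (x (i + j)%N) _ _) _.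
  apply: le_trans (lerD ih (h _)) _.
  have -> : e / 2 ^+ (i + j) = e / 2 ^+ (i + j).+1 + e / 2 ^+ (i + j).+1.
    by rewrite -mulr2n -mulr_natr exprS invfM; field; rewrite expf_neq0.
  lra.
have e0 : 0 <= e by have := le_trans (tdist_ge0 _ _) (h 0%N); rewrite pmulr_lge0.
have distle i j : (i <= j)%N -> tdist (x i) (x j) <= e / 2 ^+ i.
  move=> /subnKC <-; apply: le_trans (dist_ _ _) _.
  by rewrite lerBlDr lerDl divr_ge0// exprn_ge0.
have limk k : exists y : C, (fun j => x j ord0 k) @ \oo --> y.
  apply: car_complete; apply: cauchy_exP => d d0.
  have [i hi] := half_lt e d0; exists (x i ord0 k); exists i => // j /= ij.
  rewrite ballEmdist /=; apply: le_lt_trans hi; apply: le_trans (distle _ _ ij).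
  exact: (le_bigmax 0 (fun k => mdist (x i ord0 k) (x j ord0 k))).
have [l lP] := choice limk; exists (\row_k l k) => j.
apply/ler_addgt0Pl => d d0.
have near_ k : exists i, forall i', (i <= i')%N -> mdist (x i' ord0 k) (l k) < d.
  have /(_ _ (nbhsx_ballx _ _ d0)) := lP k; rewrite nbhs_filterE => -[i _ hi].
  exists i => i' /hi /=; by rewrite ballEmdist /= mdistC.
have [f fP] := choice near_.
pose N := (j + \max_k f k)%N.
apply: le_trans (tdist_triangle (x N) _ _) _; rewrite addrC lerD//.
  rewrite ltW//; apply/tdist_lt => // k; rewrite mxE; apply: fP.
  by rewrite /N (leq_trans (leq_bigmax k))// leq_addl.
by apply: distle; exact: leq_addr.
Qed.

(** Dependent choice with halving steps, shared by two walks: one inside a model towards a definable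
    set, the other down the levels of the function [f] belonging to a pre-minimal type. *)
Lemma tdist_limit n (Inv : nat -> set 'rV[C]_n) (e : R) (a : 'rV[C]_n) :
  Inv 0%N a ->
  (forall j b, Inv j b -> exists2 c, Inv j.+1 c & tdist b c <= e / 2 ^+ j.+1) ->
  exists x : nat -> 'rV[C]_n, exists l, [/\ x 0%N = a, forall j, Inv j (x j) &
    forall j, tdist (x j) l <= e / 2 ^+ j].
Proof.
move=> Inv0 step.
have /choice[f fP] : forall p : nat * 'rV[C]_n, exists c, Inv p.1 p.2 ->
    Inv p.1.+1 c /\ tdist p.2 c <= e / 2 ^+ p.1.+1.
  move=> [j b]; have [/step[c ? ?]|nI] := pselect (Inv j b); first by exists c.
  by exists b => /nI.
pose x := fix x j := if j is j'.+1 then f (j', x j') else a.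
have Invx j : Inv j (x j).
  by elim: j => //= j ih; have [] := fP (j, x j) ih.
have [l lP] : exists l, forall j, tdist (x j) l <= e / 2 ^+ j.
  by apply: tdist_cauchy => j; have [_] := fP (j, x j) (Invx j).
by exists x, l.
Qed.

Lemma tuples_in_closed M n (l : 'rV[C]_n) : closed M ->
  (forall e, 0 < e -> exists2 m, tuples_in M m & tdist m l < e) -> tuples_in M l.
Proof.
move=> clM h i; apply: clM => U /nbhs_ballP[e /= e0 eU].
have [m Mm /(tdist_lt _ _ e0)/(_ i) mi] := h e e0; exists (m ord0 i); split=> //.
by apply: eU; rewrite ballEmdist /= mdistC.
Qed.

(** A tuple of [M] within [r] of [D] can be moved by less than [r] to a tuple of [M] that is within
    a prescribed [s] of [D]. Iterating with [r] = e, e/2, e/4, ... costs at most 2e in total, and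
    the limit lies both in [M] and in [D]. *)
Lemma definable_model_point n A (D : set (tspace n A)) M (a c : 'rV[C]_n) e :
  small A -> definable D -> model M -> A `<=` M -> 0 < e ->
  tuples_in M a -> D (tp A c) -> tdist a c < e ->
  exists2 m, realizations D M m & tdist a m <= 2 * e.
Proof.
move=> sA [clD _ defD] mM AM e0 Ma Dc ac.
(* Being within [r] of [b] and near the type of [d] is a condition over [M], met by some [m] by
   density; as [m] lies in the neighbourhood [U] of [D], it is within [s] of [D]. *)
have step (b d : 'rV[C]_n) r s : 0 < r -> 0 < s -> D (tp A d) -> tdist b d < r ->
    tuples_in M b -> exists m, [/\ tuples_in M m, tdist b m < r &
      exists2 d', D (tp A d') & tdist m d' < s].
  move=> r0 s0 Dd bd Mb; have [U [oU DU Us]] := defD s s0.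
  have /tspace_nbhs[phi phi0 phiU] : nbhs (tp A d) U.
    by apply: open_nbhs_nbhs; split=> //; have [] := DU _ Dd.
  pose psi : formula R L M n := fmaxs (fun i : 'I_2 => if i == ord0 then
      frename (par_incl AM) phi
    else fmaxs (fun j => fdev 0 r (fdist R (tpar L n (SigSub (mem_set (Mb j)))) (tvar L M j)))).
  have psiP y : feval setT set_val psi y < 1 <->
      feval setT set_val phi y < 1 /\ tdist b y < r.
    rewrite feval_fmaxs_lt//.
    have E0 : feval setT set_val (frename (par_incl AM) phi) y = feval setT set_val phi y.
      by rewrite feval_rename.
    have E1 : feval setT set_val (fmaxs (fun j => fdev 0 r
        (fdist R (tpar L n (SigSub (mem_set (Mb j)))) (tvar L M j)))) y < 1 <-> tdist b y < r.
      rewrite feval_fmaxs_lt// tdist_lt//; split=> h i; have := h i;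
        by rewrite feval_fdev /= subr0 ger0_norm ?mdist_ge0// ltr_pdivrMr// mul1r.
    split=> [h|[h1 h2] i].
      by split; [rewrite -E0; exact: (h ord0)|apply/E1; exact: (h ord_max)].
    by case: ifP => _; [rewrite E0|apply/E1].
  have [|m Mm /psiP[h1 h2]] := @model_dense M n psi d 1 mM.
    by apply/psiP; rewrite -tev_tp phi0.
  exists m; split=> //.
  have /Us/(thickenP _ _ _ sA) : (U `&` setT) (tp A m) by split=> //; exact: phiU.
  by move=> [d' Dd' md']; exists d'.
pose Inv j : set 'rV[C]_n := [set b | tuples_in M b /\
  exists2 d, D (tp A d) & tdist b d < e / 2 ^+ j].
have [||x [l [x0 xI xl]]] := @tdist_limit n Inv (2 * e) a.
- by split=> //; exists c; rewrite // expr0 divr1.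
- move=> j b [Mb [d Dd bd]].
  have p k : 0 < e / 2 ^+ k by rewrite divr_gt0// exprn_gt0.
  have [m [Mm bm md]] := step b d _ _ (p j) (p j.+1) Dd bd Mb.
  exists m => //; rewrite ltW// (lt_le_trans bm)// exprS invfM mulrA.
  by rewrite [2 * e]mulrC mulfK.
have small_ d : 0 < d -> exists2 j, e / 2 ^+ j < d & 2 * e / 2 ^+ j < d.
  move=> d0; have [j hj] := half_lt (2 * e) d0; exists j => //.
  apply: le_lt_trans hj; rewrite ler_pM2r ?invr_gt0 ?exprn_gt0//.
  by rewrite ler_peMl ?ltW// ltr1n.
have clM : closed M by have [_ []] := mM.
exists l; last by have := xl 0%N; rewrite x0 expr0 divr1.
split.
  apply: tuples_in_closed => // d /small_[j _ hj]; exists (x j); first by have [] := xI j.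
  exact: le_lt_trans (xl j) hj.
apply: closed_metric => // d d0; have d20 : 0 < d / 2 by rewrite divr_gt0.
have [j hj1 hj2] := small_ _ d20; have [_ [d' Dd' xd']] := xI j.
exists d' => //; apply: le_lt_trans (tdist_triangle (x j) _ _) _.
rewrite [d]splitr ltrD//; last exact: lt_trans xd' hj1.
by rewrite tdistC (le_lt_trans (xl j)).
Qed.

End Models.

(** * Zerosets and definable sets *)

Section Zerosets.
Context (R : realType) (L : language) (C : monster R L) (n : nat).
Implicit Types (A B M : set C).

Lemma urysohn A (F G : set (tspace n A)) : small A -> closed F -> closed G ->
  F `&` G = set0 -> exists f : tspace n A -> R, [/\ continuous f,
    forall p, 0 <= f p <= 1, forall p, F p -> f p = 0 & forall p, G p -> f p = 1].
Proof.
move=> sA clF clG FG.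
have nrm : normal_space (tspace n A).
  by apply: compact_normal; [exact: tspace_hausdorff|exact: tspace_compact].
have /(uniform_separatorP (R := R))[f [cf f01 f0 f1]] :=
  (normal_separatorP (R := R)).1 nrm F G clF clG FG.
exists f; split=> // p; first by have := f01 _ (imageT f p); rewrite /= in_itv.
  by move=> Fp; apply: f0; exists p.
by move=> Gp; apply: f1; exists p.
Qed.

(** The weights tend to 0, so the supremum is uniformly within [e / 2 ^+ N] of a finite maximum of
    continuous functions. *)
Lemma sup_continuous (T : topologicalType) (f : nat -> T -> R) (e : R) : 0 < e ->
  (forall k, continuous (f k)) -> (forall k p, 0 <= f k p <= 1) ->
  exists g : T -> R, [/\ continuous g, forall p, 0 <= g p,
    forall k p, e / 2 ^+ k * f k p <= g p &
    forall p, (forall k, f k p = 0) -> g p = 0].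
Proof.
move=> e0 cf f01; pose c k : R := e / 2 ^+ k.
have c0 k : 0 < c k by rewrite divr_gt0// exprn_gt0.
have cle j k : (j <= k)%N -> c k <= c j.
  by move=> jk; rewrite ler_pM2l// lef_pV2 ?posrE ?exprn_gt0// ler_eXn2l// ltr1n.
pose g p := sup (range (fun k => c k * f k p)).
have cf_le k p : c k * f k p <= c k.
  by have /andP[_ h] := f01 k p; rewrite ler_piMr// ltW.
have has_ p : has_sup (range (fun k => c k * f k p)).
  split; first by exists (c 0%N * f 0%N p); exists 0%N.
  by exists (c 0%N) => _ [k _ <-]; exact: le_trans (cf_le k p) (cle _ _ (leq0n k)).
have gge k p : c k * f k p <= g p.
  by apply: sup_ubound; [have [] := has_ p|exists k].
have g0 p : 0 <= g p.
  apply: le_trans (gge 0%N p); apply: mulr_ge0; first exact: ltW.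
  by have /andP[] := f01 0%N p.
exists g; split=> //; last first.
  move=> p fp; suff E : range (fun k => c k * f k p) = [set 0] by rewrite /g E sup1.
  apply/seteqP; split=> [_ [k _ <-]|_ ->]; first by rewrite fp mulr0.
  by exists 0%N => //; rewrite fp mulr0.
move=> p; apply/cvgrPdist_lt => d d0.
have d20 : 0 < d / 2 by rewrite divr_gt0.
have [N hN] := half_lt e d20.
pose h p := \big[Order.max/0]_(k < N) (c k * f k p).
have ch : continuous h.
  apply: continuous_bigmax => k q; apply: cvgM; first exact: cvg_cst.
  exact: cf.
have hg q : h q <= g q.
  apply: (big_ind (fun x => x <= g q)) => [|x y hx hy|k _]; first exact: g0.
    by rewrite ge_max hx.
  exact: gge.
have gh q : g q <= h q + c N.
  apply: ge_sup; first by have [] := has_ q.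
  move=> _ [k _ <-]; have [kN|Nk] := ltnP k N.
    apply: le_trans (_ : h q <= _); last by rewrite lerDl ltW.
    exact: (le_bigmax 0 (fun k : 'I_N => c k * f k q) (Ordinal kN)).
  apply: le_trans (cf_le k q) _; apply: le_trans (cle _ _ Nk) _.
  by rewrite lerDr; exact: bigmax_ge_id.
have /cvgrPdist_lt/(_ _ d20) := ch p; apply: filterS => q.
have := hg p; have := gh p; have := hg q; have := gh q; rewrite -/(c N) in hN.
rewrite !ltr_norml => h1 h2 h3 h4 /andP[h5 h6]; apply/andP; split; lra.
Qed.

(** Where the weighted supremum of the Urysohn functions vanishes, a type lies in every [U k], hence
    at distance 0 from [D], and the closed set [D] is metrically closed. *)
Lemma definable_zeroset A (D : set (tspace n A)) : small A -> definable D ->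
  zeroset D.
Proof.
move=> sA [clD _ defD].
have pos k : 0 < 1 / 2 ^+ k :> R by rewrite divr_gt0// exprn_gt0.
have /choice[U UP] : forall k : nat, exists U : set (tspace n A),
    [/\ open U, D `<=` U & U `<=` thicken D (1 / 2 ^+ k)].
  move=> k; have [U [oU DU UD]] := defD _ (pos k).
  by rewrite !setIT in DU UD; exists U.
have /choice[f fP] : forall k, exists f : tspace n A -> R, [/\ continuous f,
    forall p, 0 <= f p <= 1, forall p, D p -> f p = 0 & forall p, (~` U k) p -> f p = 1].
  move=> k; have [oU DU _] := UP k; apply: urysohn => //; first exact: open_closedC.
  by apply/seteqP; split=> // p [/DU Up].
have [||g [cg g0 gge g00]] := @sup_continuous _ f 1 ltr01.
- by move=> k; have [] := fP k.
- by move=> k; have [] := fP k.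
exists g => //; apply/seteqP; split=> p.
  by move=> Dp; apply: g00 => k; have [_ _ + _] := fP k; exact.
have [c ->] := tspace_inh p => gp; apply: closed_metric => // e e0.
have [k hk] := half_lt 1 e0; have [_ _ UD] := UP k.
have /UD/(thickenP _ _ _ sA)[b Db cb] : U k (tp A c).
  apply: contrapT => nU; have [_ _ _ /(_ _ nU) f1] := fP k.
  by have := gge k (tp A c); rewrite f1 gp mulr1 leNgt pos.
by exists b => //; exact: lt_trans hk.
Qed.

Lemma zeroset_closed A (Z : set (tspace n A)) : zeroset Z -> closed Z.
Proof.
move=> [f cf ->]; rewrite (_ : zeros f = f @^-1` [set x | x = 0]) //.
by apply: closed_comp => [p _|]; [exact: cf|exact: closed_eq].
Qed.

Lemma zerosetI A (Z Z' : set (tspace n A)) : zeroset Z -> zeroset Z' ->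
  zeroset (Z `&` Z').
Proof.
move=> [f cf ->] [g cg ->]; exists (fun p => `|f p| + `|g p|).
  by move=> p; exact: (cvgD (cvg_norm (cf p)) (cvg_norm (cg p))).
apply/seteqP; split=> p; rewrite /zeros /=; first by move=> [-> ->]; rewrite normr0 addr0.
move=> /eqP; rewrite paddr_eq0// !normr_eq0 => /andP[/eqP ? /eqP ?]; by split.
Qed.

Lemma zeroset_eq A (f : tspace n A -> R) r : continuous f ->
  zeroset [set p | f p = r].
Proof.
move=> cf; exists (fun p => `|f p - r| / 1).
  have cd := @dist_to_continuous R r 1.
  by move=> p; exact: (continuous_comp (cf p) (cd (f p))).
apply/seteqP; split=> p; rewrite /zeros /= divr1; first by move=> ->; rewrite subrr normr0.
by move=> /eqP; rewrite normr_eq0 subr_eq0 => /eqP.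
Qed.

(** Two level sets of a formula on which [p] and [q] differ, intersected with [D], which is itself a
    zeroset. *)
Lemma separate_types A (D : set (tspace n A)) p q : small A -> definable D ->
  D p -> D q -> p <> q -> exists F G : set (tspace n A),
    [/\ zeroset F, zeroset G, F `<=` D, G `<=` D & F `&` G = set0] /\ F p /\ G q.
Proof.
move=> sA dD Dp Dq pq; have [phi npq] : exists phi, tev phi p <> tev phi q.
  by apply/existsNP => h; apply: pq; apply: tev_inj => phi; exact: contrapT (h phi).
exists (D `&` [set r | tev phi r = tev phi p]), (D `&` [set r | tev phi r = tev phi q]).
split=> //; split; [| |by move=> r []|by move=> r []|].
- by apply: zerosetI; [exact: definable_zeroset|apply: zeroset_eq; exact: tev_continuous].
- by apply: zerosetI; [exact: definable_zeroset|apply: zeroset_eq; exact: tev_continuous].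
by apply/seteqP; split=> // r [[_ /= ->] [_ /=]].
Qed.

Lemma definable_over A B (AB : A `<=` B) (D : set (tspace n A)) : small B ->
  definable D -> definable (set_over AB D).
Proof.
move=> sB [clD _ defD]; have sA := small_sub AB sB.
have cr := @restr_continuous R L C n A B AB.
split=> // [|e e0]; first by apply: closed_comp => // p _; exact: cr.
have [U [oU DU UD]] := defD e e0; exists (restr AB @^-1` U); split.
- by apply: open_comp => // p _; exact: cr.
- by move=> q /DU[Uq _].
move=> q; have [c ->] := tspace_inh q => -[Uc _].
have /UD : (U `&` setT) (tp A c) by split=> //; move: Uc; rewrite /= restr_tp.
move=> /(thickenP _ _ _ sA)[b Db cb]; apply/thickenP => //.
by exists b => //; rewrite /set_over /= restr_tp.
Qed.

Lemma definable0 A : definable (set0 : set (tspace n A)).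
Proof.
split=> // [|e e0]; first exact: closed0.
by exists set0; rewrite setIT; split=> //; exact: open0.
Qed.

Lemma definableU A (D E : set (tspace n A)) : small A -> definable D ->
  definable E -> definable (D `|` E).
Proof.
move=> sA [clD _ dD] [clE _ dE]; split=> // [|e e0]; first exact: closedU.
have [U [oU DU UD]] := dD e e0; have [V [oV EV VE]] := dE e e0.
exists (U `|` V); split; first exact: openU.
  by move=> p [/DU[]|/EV[]] ? _; split=> //; [left|right].
move=> p; have [c ->] := tspace_inh p => -[[Uc|Vc] _]; apply/thickenP => //.
  have /UD/(thickenP _ _ _ sA)[b Db cb] : (U `&` setT) (tp A c) by [].
  by exists b => //; left.
have /VE/(thickenP _ _ _ sA)[b Db cb] : (V `&` setT) (tp A c) by [].
by exists b => //; right.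
Qed.

(** Near-covering compactness is applied to the filter of finite lists directed by inclusion. *)
Lemma compact_finite_cover (T : topologicalType) (I : eqType) (K : set T)
    (U : I -> set T) : compact K -> (forall x, K x -> exists i, nbhs x (U i)) ->
  exists s : seq I, forall x, K x -> exists2 i, i \in s & U i x.
Proof.
move=> /compact_near_coveringP nc cov.
pose F : set_system (seq I) :=
  filter_from setT (fun s0 : seq I => [set s : seq I | {subset s0 <= s}]).
have FF : Filter F.
  apply: filter_from_filter; first by exists [::].
  move=> s t _ _; exists (s ++ t) => // u h; split=> x xs; apply: h;
    by rewrite mem_cat xs ?orbT.
have [|s _ hs] := nc (seq I) F (fun s x => exists2 i, i \in s & U i x) FF.
  move=> x /cov[i Ui]; exists (U i, [set s : seq I | i \in s]) => /=.
    by split=> //; exists [:: i] => // s; apply; exact: mem_head.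
  by move=> [y s] /= [Uy si]; exists i.
by exists s; exact: hs.
Qed.

(** Finitely many definable neighbourhoods cover the compact set [K], and definable sets are closed
    under finite unions. *)
Lemma dictionaric_cover A (K F : set (tspace n A)) : small A -> dictionaric n A ->
  closed K -> closed F -> K `&` F = set0 ->
  exists D, [/\ definable D, K `<=` D & D `&` F = set0].
Proof.
move=> sA dict clK clF KF.
pose I := {classic {D : set (tspace n A) | definable D /\ D `&` F = set0}}.
have cK : compact K.
  by apply: subclosed_compact; [exact: clK|exact: tspace_compact|by []].
have [p Kp|s sP] := @compact_finite_cover _ I K (fun D => sval D) cK.
  have nFp : ~ F p by move=> Fp; have : (K `&` F) p by []; rewrite KF.
  have [D [dD Dp DF]] := dict p F clF nFp.
  by exists (exist _ D (conj dD DF)).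
suff [D [dD sD DF]] : exists D, [/\ definable D,
    forall i : I, i \in s -> sval i `<=` D & D `&` F = set0].
  by exists D; split=> // p /sP[i si ip]; exact: sD si _ ip.
elim: s {sP} => [|i s [D [dD sD DF]]].
  by exists set0; split=> //; [exact: definable0|rewrite set0I].
have [di iF] := svalP i; exists (sval i `|` D); split.
- exact: definableU.
- move=> j; rewrite inE => /orP[/eqP ->|/sD h] p hp; [by left|by right; exact: h].
- by rewrite setIUl iF DF setU0.
Qed.

End Zerosets.

(** * Algebraic types *)

Section Algebraic.
Context (R : realType) (L : language) (C : monster R L) (n : nat).
Implicit Types (A B M : set C).

Lemma small_setU A B : small A -> small B -> small (A `|` B).
Proof.
move=> /smallP sA /smallP sB; apply/smallP; apply: small_type_setU => //.
exact: monster_strong_limit (monsterP C).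
Qed.

Lemma type_closed A (p : tspace n A) : closed [set p].
Proof.
exact: accessible_closed_set1 (hausdorff_accessible (@tspace_hausdorff R L C n A)) _.
Qed.

Definition fdist_to A (b : 'rV[C]_n) (Ab : tuples_in A b) : formula R L A n :=
  fmaxs (fun j => fdist R (tvar L A j) (tpar L n (SigSub (mem_set (Ab j))))).

Lemma feval_fdist_to A (b : 'rV[C]_n) (Ab : tuples_in A b) c :
  feval setT set_val (fdist_to Ab) c = tdist c b.
Proof. by apply: eq_bigr => j _; rewrite mxE. Qed.

Lemma tdist_tp A (a b c : 'rV[C]_n) : tuples_in A b -> tp A a = tp A c ->
  tdist a b = tdist c b.
Proof.
by move=> Ab /tp_eqP/(_ (fdist_to Ab)); rewrite !feval_fdist_to.
Qed.

Lemma nbhs_tdist A (b c : 'rV[C]_n) e : tuples_in A b -> tdist c b < e ->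
  nbhs (tp A c) [set q | forall c', q = tp A c' -> tdist c' b < e].
Proof.
move=> Ab cb; have : nbhs (tp A c) (tev (fdist_to Ab) @^-1` [set x | x < e]).
  apply: tev_continuous; apply: open_nbhs_nbhs; split; first exact: open_lt.
  by rewrite /= tev_tp feval_fdist_to.
by apply: filterS => q /= h c' qE; rewrite qE tev_tp feval_fdist_to in h.
Qed.

Definition net A (X : set (tspace n A)) (s : seq 'rV[C]_n) e : Prop :=
  forall c, X (tp A c) -> exists2 m, m \in s & tdist c m < e.

(** Over [M], being within [e] of a given tuple of [M] is an open condition on the type, so
    compactness of the types over [M] makes the list finite. *)
Lemma finite_net A M (X : set (tspace n A)) e : model M -> A `<=` M -> closed X ->
  (forall c, X (tp A c) -> exists2 m, tuples_in M m & tdist c m < e) ->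
  exists2 s, (forall m, m \in s -> tuples_in M m) & net X s e.
Proof.
move=> mM AM clX h; have sA := small_sub AM mM.1.
pose K := restr AM @^-1` X.
have cK : compact K.
  apply: subclosed_compact; [|exact: (@tspace_compact R L C n M mM.1)|by []].
  by apply: closed_comp => // q _; exact: restr_continuous.
pose I := {m : 'rV[C]_n | m \in tuples_in M (k := n)}.
have [q Kq|s sP] := @compact_finite_cover _ I K
    (fun m => [set q | forall c', q = tp M c' -> tdist c' (val m) < e]) cK.
  have [c qE] := tspace_inh q; rewrite qE /K /= restr_tp in Kq *.
  have [m Mm cm] := h c Kq; exists (exist _ m (mem_set Mm)).
  exact: nbhs_tdist.
exists [seq val m | m <- s].
  by move=> m /mapP[m' _ ->]; exact: (set_mem (valP m')).
move=> c Xc; have [|m ms hm] := sP (tp M c); first by rewrite /K /= restr_tp.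
by exists (val m); [exact: map_f|exact: hm].
Qed.

Lemma realizations_closed A M (X : set (tspace n A)) : closed M -> closed X ->
  closed (realizations X M).
Proof.
move=> clM clX; rewrite (_ : realizations X M =
  tuples_in M (k := n) `&` (@tp R L C n A @^-1` X)) //; apply: closedI.
  move=> l cl; apply: tuples_in_closed => // e e0.
  have [m [Mm /(tdist_ball _ _ e0) lm]] := cl _ (nbhsx_ballx l e e0).
  by exists m => //; rewrite tdistC.
by apply: closed_comp => // c _; exact: tp_continuous.
Qed.

Lemma ultra_cover T (I : eqType) (F : set_system T) (s : seq I) (V : I -> set T) :
  UltraFilter F -> F [set t | exists2 i, i \in s & V i t] ->
  exists2 i, i \in s & F (V i).
Proof.
move=> FU; have FF : ProperFilter F by exact: ultra_proper.
elim: s => [|i s ih] Fs; first by have [t []] := filter_ex Fs.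
have [Vi|nVi] := in_ultra_setVsetC (V i) FU; first by exists i; rewrite ?mem_head.
have [|j js Vj] := ih; last by exists j; rewrite // inE js orbT.
apply: filterS2 Fs nVi => t [j]; rewrite inE => /orP[/eqP -> //|js Vj _].
by exists j.
Qed.

(** An ultrafilter on [S] contains a ball of each radius, so its coordinates are Cauchy and converge
    by completeness of [C]. *)
Lemma totally_bounded_compact M (S : set 'rV[C]_n) : closed S ->
  (forall e, 0 < e -> exists s : seq 'rV[C]_n, forall c, S c ->
    exists2 m, m \in s & tdist c m < e) -> compact S.
Proof.
move=> clS tb; rewrite compact_ultra => F FU FS.
have FF : ProperFilter F by exact: ultra_proper.
have limi i : exists y : C, (fun c : 'rV[C]_n => c ord0 i) @ F --> y.
  apply: car_complete; apply: cauchy_exP => e e0.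
  have [s sP] := tb e e0.
  have [|m _ Fm] := @ultra_cover _ _ F s (fun m => [set c | tdist c m < e]) FU.
    by apply: filterS FS => c /sP.
  exists (m ord0 i); rewrite ballEmdist.
  have : F [set c : 'rV[C]_n | mdist (m ord0 i) (c ord0 i) < e]; last by [].
  by apply: filterS Fm => c /(tdist_lt _ _ e0)/(_ i); rewrite mdistC.
have [l lP] := choice limi.
have Fl : F --> (\row_i l i : 'rV[C]_n).
  move=> U /nbhs_ballP[e /= e0 eU].
  have : F [set c : 'rV[C]_n | forall i, i \in enum 'I_n -> mdist (l i) (c ord0 i) < e].
    apply: filter_seq => i _; have := lP i _ (nbhsx_ballx _ _ e0).
    by rewrite ballEmdist.
  apply: filterS => c h; apply: eU; apply/(near_row_ball _ _ e0) => i.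
  by rewrite mxE; apply: h; rewrite mem_enum.
exists (\row_i l i); split=> //; apply: clS => U /Fl FUU.
exact: filter_ex (filterI FS FUU).
Qed.

Lemma lt_algebraic_algebraic A (X : set (tspace n A)) : small A -> closed X ->
  (forall e, 0 < e -> X `<=` lt_algebraic e) -> algebraic X.
Proof.
move=> sA clX h M mM AM; have clM : closed M by have [_ []] := mM.
apply: totally_bounded_compact => //; first exact: realizations_closed.
move=> e e0; have [|s _ sP] := @finite_net A M X e mM AM clX.
  by move=> c /(h e e0)/(lt_algebraicP _ _ sA)/(_ M mM AM c erefl).
by exists s => c [_ Xc]; exact: sP.
Qed.

Lemma small_coords_seq A (s : seq 'rV[C]_n) : small A ->
  exists B, [/\ small B, A `<=` B & forall b, b \in s -> tuples_in B b].
Proof.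
move=> sA; elim: s => [|c s [B [sB AB hB]]]; first by exists A; split.
exists (B `|` range (c ord0)); split; first exact: small_coords.
  by move=> x /AB; left.
move=> b; rewrite inE => /orP[/eqP -> i|/hB h i]; first by right; exists i.
by left; exact: h.
Qed.

(* If a realization [c] of [p] stays at distance [e] from [M], coheirs of [M] yield
   an infinite [e]-separated sequence of realizations of [tp M c]: the distance
   from an earlier term to the tuples of [M] is at least [e], and this passes to the
   coheir. *)
Lemma algebraic_lt_algebraic A (p : tspace n A) e : small A -> algebraic [set p] ->
  0 < e -> lt_algebraic e p.
Proof.
move=> sA alg e0; have [c0 pE] := tspace_inh p; rewrite pE in alg *.
apply/lt_algebraicP => // M mM AM c cc0; apply: contrapT => far_.
have {}far_ m : tuples_in M m -> e <= tdist c m.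
  by move=> Mm; rewrite leNgt; apply/negP => cm; apply: far_; exists m.
have ext (s : seq 'rV[C]_n) : exists c', (forall b, b \in s -> tp M b = tp M c) ->
    tp M c' = tp M c /\ forall b, b \in s -> e <= tdist c' b.
  have [sM|ns] := pselect (forall b, b \in s -> tp M b = tp M c); last first.
    by exists c => /ns.
  have [B [sB MB hB]] := small_coords_seq s mM.1.
  have [c' c'c h] := coheir c mM sB MB; exists c' => _; split=> // b bs.
  rewrite -(feval_fdist_to (hB b bs)); apply: h => m Mm.
  rewrite feval_fdist_to tdistC (tdist_tp Mm (sM b bs)); exact: far_.
have [f fP] := choice ext.
pose s := fix s k := if k is k'.+1 then f (s k') :: s k' else [::].
have sM k b : b \in s k -> tp M b = tp M c.
  elim: k b => //= k ih b; rewrite inE => /orP[/eqP ->|/ih //].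
  by have [] := fP (s k) ih.
pose x k := f (s k).
have xM k : tp M (x k) = tp M c by have [] := fP (s k) (@sM k).
have xs j k : (j < k)%N -> x j \in s k.
  elim: k => // k ih; rewrite ltnS leq_eqVlt => /orP[/eqP ->|/ih h] /=.
    exact: mem_head.
  by rewrite inE h orbT.
have xd j k : (j < k)%N -> e <= tdist (x k) (x j).
  by move=> jk; have [_] := fP (s k) (@sM k); apply; exact: xs.
have [N mN AN] : exists2 N, model N & A `|` range (fun p : nat * 'I_n => x p.1 ord0 p.2) `<=` N.
  apply: loewenheim_skolem; apply: small_setU => //; apply/smallP.
  apply: small_type_image; apply: small_type_count.
  exact: monster_uncountable (monsterP C).
have NX k : realizations [set tp A c0] N (x k).
  split; first by move=> i; apply: AN; right; exists (k, i).
  by rewrite /= -cc0; exact: tp_restr_eq AM _ _ (xM k).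
have cN : compact (realizations [set tp A c0] N).
  by apply: alg => // y Ay; apply: AN; left.
have [|l [_ cl]] := cN (x @ \oo) _; first by exists 0%N => // k _; exact: NX.
have e20 : 0 < e / 2 by rewrite divr_gt0.
have close N0 : exists2 k, (N0 <= k)%N & tdist l (x k) < e / 2.
  have [|y [[k Nk <-] /(tdist_ball _ _ e20) h]] :=
      cl (x @` [set k | (N0 <= k)%N]) _ _ (nbhsx_ballx l _ e20).
    by exists N0 => // k /= Nk; exists k.
  by exists k.
have [i _ hi] := close 0%N; have [j ij hj] := close i.+1.
have := xd _ _ ij; rewrite leNgt => /negP; apply.
apply: le_lt_trans (tdist_triangle l _ _) _.
by rewrite [e]splitr tdistC ltrD.
Qed.

(* Model independence: the net need not consist of tuples of [M], since over
   [M] it can be replaced by a conjugate coheir of [M]. *)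
Lemma net_lt_algebraic A (p : tspace n A) s e : small A -> net [set p] s e ->
  lt_algebraic e p.
Proof.
move=> sA; have [c0 ->] := tspace_inh p => hs; apply/lt_algebraicP => // M mM AM c cc0.
apply: contrapT => far_.
have {}far_ m : tuples_in M m -> e <= tdist c m.
  by move=> Mm; rewrite leNgt; apply/negP => cm; apply: far_; exists m.
(* All coordinates of the net form one tuple, so that a single coheir and a single automorphism move
   all its points simultaneously. *)
pose J := ('I_(size s) * 'I_n)%type.
pose m0 := \row_(k < #|{: J}|) (nth c s (enum_val k).1) ord0 (enum_val k).2.
have [B [sB MB hB]] := small_coords_seq [:: c] mM.1.
have Bc : tuples_in B c by apply: hB; exact: mem_head.
have [m1 m1m0 hm1] := coheir m0 mM sB MB.
have [sg [asg sgM sgm]] := homogeneity mM.1 (esym m1m0).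
have [sgi [sg1 sg2]] : exists sgi, cancel sg sgi /\ cancel sgi sg.
  by have [[t h1 h2] _ _ _] := asg; exists t.
(* Instead of moving the net, [c] is pulled back: [c'] still realizes [p], so it is near a net point
   [m], and [sg] carries this to a point of the coheir within [e] of [c], against the lower bound
   [e] inherited from [M]. *)
pose c' := map_mx sgi c.
have c'c : map_mx sg c' = c by apply/rowP => i; rewrite !mxE sg2.
have [|m ms c'm] := hs c'.
  rewrite /= -cc0 -[in RHS]c'c automorphism_tp// => a Aa; apply: sgM; exact: AM.
have sm : (index m s < size s)%N by rewrite index_mem.
pose i0 : 'I_(size s) := Ordinal sm.
pose phi : formula R L B #|{: J}| := fmaxs (fun j : 'I_n =>
  fdist R (tpar L _ (SigSub (mem_set (Bc j)))) (tvar L B (enum_rank (i0, j)))).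
have phiE y : feval setT set_val phi y = tdist c (\row_j y ord0 (enum_rank (i0, j))).
  by apply: eq_bigr => j _; rewrite !mxE.
have : e <= feval setT set_val phi m1.
  by apply: hm1 => m' Mm'; rewrite phiE; apply: far_ => j; rewrite mxE; exact: Mm'.
rewrite phiE; apply/negP; rewrite -ltNge; move: c'm; rewrite -(automorphism_tdist _ _ asg) c'c.
congr (tdist _ _ < _); apply/rowP => j; rewrite -sgm !mxE enum_rankK /=.
by rewrite nth_index.
Qed.

(** Over one model [M], the types within [e] of a finite net for [p] form an open set [V]. The
    restrictions to [A] of the types outside [V] form a closed set that omits [p]; a type off this
    closed set has all its realizations near the net, which suffices for every model by
    [net_lt_algebraic]. *)
Lemma lt_algebraic_open A e : small A -> open [set p : tspace n A | lt_algebraic e p].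
Proof.
move=> sA; rewrite openE => p ap.
have [M mM AM] := loewenheim_skolem sA.
have [c0 pE] := tspace_inh p.
have [|s sM sP] := @finite_net A M [set p] e mM AM (@type_closed A p).
  by move=> c /= cp; move: ap; rewrite /= -cp => /(lt_algebraicP _ _ sA)/(_ M mM AM c erefl).
pose V := [set q : tspace n M | exists2 m, m \in s & forall c', q = tp M c' -> tdist c' m < e].
have oV : open V.
  rewrite openE => q [m ms hm]; have [c qE] := tspace_inh q; rewrite qE.
  have := nbhs_tdist (sM m ms) (hm c qE); rewrite /interior.
  by apply: filterS => r hr; exists m.
have cV : compact (~` V).
  by apply: subclosed_compact; [exact: open_closedC|exact: (@tspace_compact R L C n M mM.1)|].
have clV : closed (restr AM @` (~` V)).
  apply: compact_closed; first exact: tspace_hausdorff.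
  by apply: continuous_compact => //; apply: continuous_subspaceT; exact: restr_continuous.
have Vp : (~` (restr AM @` (~` V))) p.
  move=> [q + qp]; have [c qE] := tspace_inh q; apply; rewrite qE.
  have [|m ms cm] := sP c; first by rewrite /= -qp qE restr_tp.
  by exists m => // c' cc'; rewrite -(tdist_tp (sM m ms) cc').
have : nbhs p (~` (restr AM @` (~` V))).
  by apply: open_nbhs_nbhs; split=> //; exact: closed_openC.
rewrite /interior; apply: filterS => q Vq; apply: (net_lt_algebraic (s := s)) => // c /= cq.
have : V (tp M c) by apply: contrapT => nV; apply: Vq; exists (tp M c); rewrite ?restr_tp.
by move=> [m ms hm]; exists m => //; exact: hm.
Qed.

Lemma lt_algebraic_le A (p : tspace n A) e e' : small A -> e <= e' ->
  lt_algebraic e p -> lt_algebraic e' p.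
Proof.
move=> sA ee'; have [c ->] := tspace_inh p => /(lt_algebraicP _ _ sA) h.
apply/lt_algebraicP => // M mM AM b bc; have [m Mm bm] := h M mM AM b bc.
by exists m => //; exact: lt_le_trans ee'.
Qed.

Lemma algebraic_subset A (X Y : set (tspace n A)) : closed X -> X `<=` Y ->
  algebraic Y -> algebraic X.
Proof.
move=> clX XY alg M mM AM; have clM : closed M by have [_ []] := mM.
apply: subclosed_compact (alg M mM AM) _; first exact: realizations_closed.
by move=> c [Mc /XY].
Qed.

(** Each type of [X] is (<e)-algebraic for every [e], and compactness of the closed set [X] turns
    this into finite nets for all of [X], however many types it has. *)
Lemma algebraic_types A (X : set (tspace n A)) : small A -> closed X ->
  (forall p, X p -> algebraic [set p]) -> algebraic X.
Proof.
move=> sA clX h; apply: lt_algebraic_algebraic => // e e0 p Xp.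
by apply: algebraic_lt_algebraic => //; exact: h.
Qed.

Lemma algebraic_realized A (a : 'rV[C]_n) : tuples_in A a -> algebraic [set tp A a].
Proof.
move=> Aa M _ AM; rewrite (_ : realizations _ _ = [set a]); first exact: compact_set1.
apply/seteqP; split=> [c [_ /= ca]|_ ->]; first by rewrite (tp_self Aa (esym ca)).
by split=> // i; apply: AM; exact: Aa.
Qed.

(** A model containing [A] embeds in one containing [B] as well, and the realizations in the smaller
    model are closed among those in the larger. *)
Lemma algebraic_over A B (AB : A `<=` B) (X : set (tspace n A)) : small B ->
  closed X -> algebraic (set_over AB X) <-> algebraic X.
Proof.
move=> sB clX.
have E M : realizations (set_over AB X) M = realizations X M.
  by apply/seteqP; split=> c [Mc Xc]; split=> //; move: Xc; rewrite /set_over /= restr_tp.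
split=> alg M mM AM; last by rewrite E; apply: alg => //; exact: subset_trans AM.
have [N mN MBN] : exists2 N, model N & M `|` B `<=` N.
  by apply: loewenheim_skolem; apply: small_setU => //; exact: mM.1.
have clM : closed M by have [_ []] := mM.
have := alg N mN (subset_trans (@subsetUr _ M B) MBN); rewrite E => cN.
apply: subclosed_compact cN _; first exact: realizations_closed.
by move=> c [Mc Xc]; split=> // i; apply: MBN; left; exact: Mc.
Qed.

End Algebraic.

(** * Approximately minimal pairs *)

Section ApproxMinimal.
Context (R : realType) (L : language) (C : monster R L) (n : nat).
Implicit Types (A B M : set C).

Lemma zeros_closed A (P : tspace n A -> R) : continuous P -> closed (zeros P).
Proof. by move=> cP; apply: zeroset_closed; exists P. Qed.

Lemma nonalgebraic_type A (p : tspace n A) : small A -> ~ algebraic [set p] ->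
  exists2 e, 0 < e & ~ lt_algebraic e p.
Proof.
move=> sA np; apply: contrapT => h; apply: np.
apply: lt_algebraic_algebraic => //; first exact: type_closed.
by move=> e e0 q -> /=; apply: contrapT => ne; apply: h; exists e.
Qed.

Lemma approx_minimal_generic A (D : set (tspace n A)) (P : tspace n A -> R) :
  small A -> approx_minimal D P -> exists2 p, pair_points_to D P p &
    exists2 d0, 0 < d0 & forall d q, 0 < d -> d <= d0 -> D q -> q <> p ->
      P q <= d -> lt_algebraic d q.
Proof.
move=> sA [dD cP ZD nZ sep].
have [p Zp np] : exists2 p, zeros P p & ~ algebraic [set p].
  apply: contrapT => h; apply: nZ; apply: algebraic_types => //.
    exact: zeros_closed.
  by move=> p Zp; apply: contrapT => np; apply: h; exists p.
(* Below this [d0], of two zerosets separating [p] from [q], the one that contains [p] cannot be the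
   algebraic one. *)
have [d0 d00 nd0] := nonalgebraic_type sA np.
have near_p d q : 0 < d -> d <= d0 -> D q -> q <> p -> P q <= d -> lt_algebraic d q.
  move=> dpos dd0 Dq qp Pq; have Dp := ZD p Zp.
  have [F [G [[zF zG FD GD FG] [Fp Gq]]]] := separate_types sA dD Dp Dq (nesym qp).
  have [M mM AM] := loewenheim_skolem sA.
  have [h|h] := sep F G zF zG FD GD FG M mM AM d dpos; last by apply: h.
  exfalso; apply: nd0; apply: lt_algebraic_le dd0 _ => //; apply: h; split=> //=.
  by rewrite Zp ltW.
exists p; last by exists d0.
split=> // q Zq nq; apply: contrapT => qp; apply: nq.
apply: lt_algebraic_algebraic => //; first exact: type_closed.
move=> e e0 r ->; have m0 : 0 < Order.min e d0 by rewrite lt_min e0.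
apply: (@lt_algebraic_le _ _ _ _ _ _ (Order.min e d0)) => //.
  by rewrite ge_min lexx.
apply: near_p => //; first by rewrite ge_min lexx orbT.
  exact: ZD.
by rewrite Zq ltW.
Qed.

(** Allows shells to be measured by the absolute value of [P], so that they exhaust the points near
    the zero set and off it even where [P] is negative. *)
Lemma approx_minimal_abs A (D : set (tspace n A)) (P : tspace n A -> R) :
  approx_minimal D P -> approx_minimal D (fun p => `|P p|).
Proof.
have Z : zeros (fun p => `|P p|) = zeros P.
  apply/seteqP; split=> p; rewrite /zeros /= => /eqP; rewrite ?normr_eq0 => /eqP //.
  by move=> ->; rewrite normr0.
move=> [dD cP ZD nZ sep]; split=> //; rewrite ?Z//.
  by move=> p; exact: cvg_norm (cP p).
move=> F G zF zG FD GD FG M mM AM e e0.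
have le X : X `&` [set p | `|P p| <= e] `<=` X `&` [set p | P p <= e].
  by move=> p [Xp /= h]; split=> //=; exact: le_trans (ler_norm _) h.
by have [h|h] := sep F G zF zG FD GD FG M mM AM e e0; [left|right]; exact: subset_trans h.
Qed.

Lemma dyadic (d x : R) k : 0 < d -> 0 < x -> x <= d / 2 ^+ k ->
  exists2 j, (k <= j)%N & d / 2 ^+ j.+1 <= x <= d / 2 ^+ j.
Proof.
move=> d0 x0 xk; have [i hi] := half_lt d x0.
have ex : exists j, d / 2 ^+ j.+1 <= x.
  exists i; apply: le_trans (ltW hi); rewrite ler_pM2l// lef_pV2 ?posrE ?exprn_gt0//.
  by rewrite ler_eXn2l// ltr1n.
have mono a b : (a <= b)%N -> d / 2 ^+ b <= d / 2 ^+ a.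
  by move=> ab; rewrite ler_pM2l// lef_pV2 ?posrE ?exprn_gt0// ler_eXn2l// ltr1n.
have [kx|kx] := leP (d / 2 ^+ k.+1) x; first by exists k; rewrite // kx xk.
case: (ex_minnP ex) => j jx jmin; exists j.
  by rewrite leqNgt; apply/negP => jk; move: kx; rewrite ltNge (le_trans (mono _ _ _) jx)// ltnW.
rewrite jx /=; case: j jx jmin => [|j] _ jmin.
  by apply: le_trans xk (mono _ _ _).
by rewrite leNgt; apply/negP => h; have := jmin j (ltW h); rewrite ltnn.
Qed.

Lemma seq_types_closed A (s : seq 'rV[C]_n) :
  closed [set q : tspace n A | exists2 m, m \in s & q = tp A m].
Proof.
elim: s => [|m s ih].
  by rewrite (_ : mkset _ = set0); [exact: closed0|apply/seteqP; split=> // q []].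
rewrite (_ : mkset _ = [set tp A m] `|` [set q : tspace n A | exists2 m, m \in s & q = tp A m]).
  by apply: closedU => //; exact: type_closed.
apply/seteqP; split=> q.
  by move=> [b]; rewrite inE => /orP[/eqP -> ->|bs ->]; [left|right; exists b].
by move=> [->|[b bs ->]]; [exists m => //; exact: mem_head|exists b; rewrite // inE bs orbT].
Qed.

Lemma minimal_core A (D : set (tspace n A)) (P : tspace n A -> R) M (AM : A `<=` M) :
  model M -> definable D -> continuous P ->
  approx_minimal (set_over AM D) (formula_over AM P) ->
  exists E : set (tspace n (params D M)), [/\ definable E,
    forall c, E (tp _ c) -> D (tp A c),
    forall c, P (tp A c) = 0 -> E (tp _ c) &
    forall c, E (tp _ c) -> P (tp A c) <> 0 -> realizations D M c].
Proof.
move=> mM dD cP am; have sA := small_sub AM mM.1.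
set B := params D M.
have AB : A `<=` B by move=> x Ax; right.
have BM : B `<=` M := params_sub AM.
have sB : small B := small_sub BM mM.1.
pose Q c := `|P (tp A c)|.
have ZD c : P (tp A c) = 0 -> D (tp A c).
  have [_ _ ZD _ _] := am => Pc; have := ZD (tp M c).
  by rewrite /zeros /formula_over /set_over /= restr_tp; apply.
have [p [Zp _ _] [d0 d00 gen]] := approx_minimal_generic mM.1 (approx_minimal_abs am).
have unif e : 0 < e -> exists2 d, 0 < d & forall a b, tdist a b < d -> `|Q a - Q b| < e.
  move=> e0; have [d dpos h] := continuous_metric sA cP e0; exists d => // a b ab.
  exact: le_lt_trans (ler_dist_dist _ _) (h a b ab).
pose eps k : R := d0 / 2 ^+ k.
have eps0 k : 0 < eps k by rewrite divr_gt0// exprn_gt0.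
have epsle a b : (a <= b)%N -> eps b <= eps a.
  by move=> ab; rewrite ler_pM2l// lef_pV2 ?posrE ?exprn_gt0// ler_eXn2l// ltr1n.
(* The third clause says that each net point is near the shell; hence [Q] tends to 0 along the nets,
   and their union accumulates only at the zero set of [P]. *)
have netk k : exists s : seq 'rV[C]_n, [/\ forall m, m \in s -> realizations D M m,
    forall c, D (tp A c) -> eps k.+1 <= Q c <= eps k -> exists2 m, m \in s & tdist c m < 3 * eps k &
    forall m, m \in s -> exists2 c, Q c <= eps k & tdist c m < 3 * eps k].
  pose X := [set q : tspace n M | set_over AM D q /\ eps k.+1 <= `|formula_over AM P q| <= eps k].
  have XE c : X (tp M c) <-> D (tp A c) /\ eps k.+1 <= Q c <= eps k.
    by rewrite /X /formula_over /set_over /= restr_tp.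
  have cr := @restr_continuous R L C n A M AM.
  have clX : closed X.
    rewrite (_ : X = set_over AM D `&`
      ((fun q => `|formula_over AM P q|) @^-1` [set x | eps k.+1 <= x] `&`
      (fun q => `|formula_over AM P q|) @^-1` [set x | x <= eps k])).
      have cf : continuous (fun q => `|formula_over AM P q|).
        by move=> q; exact: (cvg_norm (continuous_comp (cr q) (cP _))).
      apply: closedI; first by have [] := definable_over AM mM.1 dD.
      apply: closedI; apply: closed_comp => [q _|]; try exact: cf.
        exact: closed_ge.
      exact: closed_le.
    by apply/seteqP; split=> q [Dq]; [move=> /andP[]|move=> [h1 h2]; split=> //; apply/andP].
  have [|s sM sX] := @finite_net _ _ _ _ M M X (eps k) mM (@subset_refl _ M) clX.
    move=> c /XE[Dc Qc].
    have : lt_algebraic (eps k) (tp M c).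
      apply: gen => //; first by rewrite -[leRHS]divr1 -(expr0 2) epsle.
      - by rewrite /set_over /= restr_tp.
      - move=> cp; move: Zp; rewrite -cp /zeros /formula_over /= restr_tp -/(Q c) => Q0.
        by move: Qc; rewrite Q0 leNgt eps0.
      - by rewrite /formula_over /= restr_tp; have /andP[] := Qc.
    by move=> /(lt_algebraicP _ _ mM.1)/(_ M mM (@subset_refl _ M) c erefl).
  (* A net point of [M] within [eps k] of the shell is within [eps k] of [D], so it moves into D(M)
     at a cost of at most [2 * eps k]. Net points far from the shell are discarded by the filter
     below. *)
  have /choice[g gP] : forall m : 'rV[C]_n, exists m',
      m \in s -> (exists2 c, X (tp M c) & tdist c m < eps k) ->
      realizations D M m' /\ tdist m m' <= 2 * eps k.
    move=> m.
    have [[ms [c Xc cm]]|h] := pselect (m \in s /\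
        exists2 c, X (tp M c) & tdist c m < eps k).
      have /XE[Dc _] := Xc; rewrite tdistC in cm.
      by have [m' ? ?] := definable_model_point sA dD mM AM (eps0 k) (sM m ms) Dc cm; exists m'.
    by exists m => ms hc; exfalso; apply: h.
  exists [seq g m | m <- s & `[< exists2 c, X (tp M c) & tdist c m < eps k >]]; split.
  - by move=> _ /mapP[m + ->]; rewrite mem_filter => /andP[/asboolP h ms]; have [] := gP m ms h.
  - move=> c Dc Qc; have Xc : X (tp M c) by apply/XE.
    have [m ms cm] := sX c Xc; have ex : exists2 c, X (tp M c) & tdist c m < eps k by exists c.
    have [_ h] := gP m ms ex; exists (g m).
      by apply: map_f; rewrite mem_filter ms andbT; apply/asboolP.
    have := tdist_triangle m c (g m); move: cm h; lra.
  - move=> _ /mapP[m + ->]; rewrite mem_filter => /andP[/asboolP h ms].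
    have [_ mgm] := gP m ms h; have [c Xc cm] := h; exists c.
      by have /XE[_ /andP[]] := Xc.
    have := tdist_triangle m c (g m); move: cm mgm; lra.
have [s sP] := choice netk.
have sD k m : m \in s k -> realizations D M m by have [+ _ _] := sP k; exact.
have sB' k m : m \in s k -> tuples_in B m.
  by move=> /sD h i; left; exists m => //; exists i.
have sQ d : 0 < d -> exists N, forall k m, (N <= k)%N -> m \in s k -> Q m < d.
  move=> dpos; have d20 : 0 < d / 2 by rewrite divr_gt0.
  have [eta eta0 heta] := unif _ d20.
  have [i hi] := half_lt (3 * d0) eta0; have [j hj] := half_lt d0 d20.
  exists (maxn i j) => k m; rewrite geq_max => /andP[ik jk] ms.
  have [_ _ /(_ m ms)[c Qc cm]] := sP k.
  have h1 : 3 * eps k < eta by apply: le_lt_trans hi; rewrite -mulrA ler_pM2l// epsle.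
  have := heta _ _ (lt_trans cm h1); rewrite ltr_norml => /andP[h2 h3].
  have := epsle _ _ jk; move: hj Qc h2 h3; rewrite -/(eps j); lra.
pose P0 (q : tspace n B) := `|P (restr AB q)|.
have P0E c : P0 (tp B c) = Q c by rewrite /P0 restr_tp.
have cP0 : continuous P0.
  by move=> q; exact: (cvg_norm (continuous_comp (@restr_continuous R L C n A B AB q) (cP _))).
pose fin N := flatten [seq s k | k <- iota 0 N].
have finP N m : m \in fin N <-> exists2 k, (k < N)%N & m \in s k.
  split=> [/flattenP[_ /mapP[k + ->] ms]|[k kN ms]].
    by rewrite mem_iota /= add0n => kN; exists k.
  by apply/flattenP; exists (s k) => //; apply: map_f; rewrite mem_iota.
(* Net points have their coordinates in [B], so each is the only realization of its type over [B],
   and [E] gains no other tuples. *)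
pose E := [set q : tspace n B | P0 q = 0 \/ exists k, exists2 m, m \in s k & q = tp B m].
have EQ c : Q c = 0 -> E (tp B c) by left; rewrite P0E.
have ES k m : m \in s k -> E (tp B m) by move=> ms; right; exists k, m.
have Ecase c : E (tp B c) -> Q c = 0 \/ exists k, c \in s k.
  move=> [h|[k [m ms h]]]; first by left; rewrite -P0E.
  by right; exists k; rewrite -(tp_self (sB' k m ms) (esym h)).
have DE c : E (tp B c) -> D (tp A c).
  move=> /Ecase[h|[k /sD[_ //]]]; apply: ZD; apply/eqP; by rewrite -normr_eq0 -/(Q c) h.
(* Near a type with [P0 q > 0] only finitely many net points matter, as [Q] exceeds half that value
   on finitely many nets only. *)
have clE : closed E.
  move=> q Eq; have [h|h] := eqVneq (P0 q) 0; first by left.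
  have r0 : 0 < P0 q by rewrite lt_neqAle eq_sym h normr_ge0.
  have [N hN] := sQ _ (divr_gt0 r0 (ltr0n R 2)).
  have [m mN qm] : [set q : tspace n B | exists2 m, m \in fin N & q = tp B m] q.
    apply: seq_types_closed => W nW.
    have nV : nbhs q (P0 @^-1` [set x | P0 q / 2 < x]).
      apply: cP0; apply: open_nbhs_nbhs; split; first exact: open_gt.
      by rewrite /= ltr_pdivrMr// ltr_pMr// ltr1n.
    have [x [Ex [Wx /= xV]]] := Eq _ (filterI nW nV); exists x; split=> //.
    case: Ex => [x0|[k [m ms xm]]]; first by move: xV; rewrite x0 ltNge divr_ge0// ltW.
    exists m => //; apply/finP; exists k => //; rewrite ltnNge; apply/negP => Nk.
    by have := hN k m Nk ms; rewrite -P0E -xm ltNge (ltW xV).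
  by have /finP[k _ ms] := mN; rewrite qm; exact: ES ms.
have close k b : D (tp A b) -> Q b <= eps k -> exists2 m, E (tp B m) & tdist b m < 3 * eps k.
  move=> Db Qb; have [Q0|Q0] := eqVneq (Q b) 0.
    by exists b; [exact: EQ|rewrite tdistxx mulr_gt0].
  have Qpos : 0 < Q b by rewrite lt_neqAle eq_sym Q0 normr_ge0.
  have [j kj hj] := dyadic d00 Qpos Qb.
  have [_ /(_ b Db hj)[m ms bm] _] := sP j; exists m; first exact: ES ms.
  by apply: lt_le_trans bm _; rewrite ler_pM2l// epsle.
exists E; split=> //.
- split=> // e e0.
  have e20 : 0 < e / 2 by rewrite divr_gt0.
  have [k hk] := half_lt (3 * d0) e20; rewrite -mulrA -/(eps k) in hk.
  have ek20 : 0 < eps k / 2 by rewrite divr_gt0.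
  have [eta eta0 heta] := unif _ ek20.
  (* Definability of [D] is used at a scale where [Q] varies by less than [eps k / 2]: a point with
     [Q] below [eps k / 2] is then near some [b] in [D] with [Q b <= eps k], and [b] is near [E].
     The net points left over are finitely many and are surrounded by balls. *)
  have m0 : 0 < Order.min eta (e / 2) by rewrite lt_min eta0.
  have [_ _ defD] := dD; have [U0 [oU0 DU0 UD0]] := defD _ m0.
  have [N hN] := sQ _ ek20.
  pose O (m : {m : 'rV[C]_n | m \in tuples_in B (k := n)}) : set (tspace n B) :=
    [set q | tev (fdist_to (set_mem (valP m))) q < e].
  exists ((restr AB @^-1` U0 `&` [set q | P0 q < eps k / 2]) `|`
    \bigcup_(m in [set m | val m \in fin N]) O m); split.
  + apply: openU.
      apply: openI.
        by apply: open_comp => // q _; exact: restr_continuous.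
      apply: (@open_comp _ _ P0 [set x | x < eps k / 2]) => [q _|]; first exact: cP0.
      exact: open_lt.
    apply: bigcup_open => m _.
    apply: (@open_comp _ _ (tev (fdist_to (set_mem (valP m)))) [set x | x < e]) => [q _|].
      exact: tev_continuous.
    exact: open_lt.
  + move=> q; have [c ->] := tspace_inh q => Ec; split=> //.
    have Dc := DE c Ec.
    have [Qc|Qc] := ltP (Q c) (eps k / 2).
      by left; split; [rewrite /= restr_tp; have [] := DU0 _ Dc|rewrite /= P0E].
    have [Q0|[j cj]] := Ecase c Ec; first by move: Qc; rewrite Q0 leNgt ek20.
    have Bc := sB' j c cj; right; exists (exist _ c (mem_set Bc)); last first.
      by rewrite /O /= tev_tp feval_fdist_to tdistxx.
    apply/finP; exists j => //; rewrite ltnNge; apply/negP => Nj.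
    by have := hN j c Nj cj; rewrite ltNge Qc.
  + move=> q; have [c ->] := tspace_inh q => -[+ _].
    move=> [[U0c /= Qc]|[m /= mN cm]]; apply/thickenP => //.
      have /UD0/(thickenP _ _ _ sA)[b Db cb] : (U0 `&` setT) (tp A c).
        by split=> //; rewrite /= restr_tp in U0c.
      rewrite P0E in Qc; rewrite lt_min in cb; have /andP[cb1 cb2] := cb.
      have Qb : Q b <= eps k.
        have := heta _ _ cb1; rewrite ltr_norml => /andP[h1 h2]; move: Qc h1 h2; lra.
      have [m Em bm] := close k b Db Qb; exists m => //.
      apply: le_lt_trans (tdist_triangle b _ _) _.
      by rewrite [e]splitr ltrD// (lt_trans bm).
    have /finP[k' _ ms] := mN; exists (val m); first exact: ES ms.
    by move: cm; rewrite /O /= tev_tp feval_fdist_to.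
- by move=> c Pc; apply: EQ; rewrite /Q Pc normr0.
- move=> c /Ecase[/eqP|[k /sD //]]; by rewrite normr_eq0 => /eqP.
Qed.

(** A type of [E] off the zero set of [P] is that of a tuple with coordinates in [B], hence
    algebraic; on the zero set only the generic type [p] is not. So a zeroset inside [E] that omits
    [p] is algebraic, and of two disjoint ones at least one omits [p]. *)
Lemma minimal_over A (D : set (tspace n A)) (P : tspace n A -> R) M
    (E : set (tspace n (params D M))) B (AB : A `<=` B) (EB : params D M `<=` B) :
  small B -> continuous P -> definable E ->
  approx_minimal (set_over AB D) (formula_over AB P) ->
  (forall c, P (tp A c) = 0 -> E (tp _ c)) ->
  (forall c, E (tp _ c) -> P (tp A c) <> 0 -> realizations D M c) ->
  minimal (set_over EB E) /\ exists p,
    pair_points_to (set_over AB D) (formula_over AB P) p /\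
    set_points_to (set_over EB E) p.
Proof.
move=> sB cP dE am ZE EZ.
have [p [Zp np uniq] _] := approx_minimal_generic sB am.
have dEB := definable_over EB sB dE.
have alg q : set_over EB E q -> q <> p -> algebraic [set q].
  have [c ->] := tspace_inh q; rewrite /set_over /= restr_tp => Ec cp.
  have [P0|P0] := pselect (P (tp A c) = 0).
    apply: contrapT => nq; apply: cp; apply: uniq => //.
    by rewrite /zeros /formula_over /= restr_tp.
  have Mc := EZ c Ec P0; apply: algebraic_realized => i; apply: (EB); left.
  by exists c => //; exists i.
have Ep : set_over EB E p.
  have [c pE] := tspace_inh p; rewrite pE /set_over /= restr_tp; apply: ZE.
  by move: Zp; rewrite pE /zeros /formula_over /= restr_tp.
have algX (X : set (tspace n B)) : zeroset X -> X `<=` set_over EB E -> ~ X p -> algebraic X.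
  move=> zX XE nXp; apply: algebraic_types => //; first exact: zeroset_closed.
  by move=> q Xq; apply: alg; [exact: XE|move=> qp; apply: nXp; rewrite -qp].
split.
  split=> // [h|F G zF zG FE GE FG].
    apply: np; refine (@algebraic_subset _ _ _ _ _ [set p] _ _ _ h); first exact: type_closed.
    by move=> q ->.
  have [Fp|nFp] := pselect (F p); last by left; exact: algX.
  by right; apply: algX => // Gp; have : (F `&` G) p by []; rewrite FG.
exists p; split; first by split.
split=> // q Eq nq; apply: contrapT => qp; apply: nq; exact: alg.
Qed.

Lemma approx_strongly_over A B (AB : A `<=` B) (D : set (tspace n A)) P : small B ->
  approx_strongly_minimal D P -> approx_minimal (set_over AB D) (formula_over AB P).
Proof.
move=> sB [dD cP h]; apply: h => //.
- exact: definable_over.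
- by move=> q; exact: (continuous_comp (@restr_continuous R L C n A B AB q) (cP _)).
- by apply/seteqP; split=> c [_ Dc]; split=> //; move: Dc; rewrite /set_over /= restr_tp.
- by move=> c; rewrite /formula_over /= restr_tp.
Qed.

(** The parameter sets [A] and [B] may be unrelated. Zerosets over [B] are zerosets over the union,
    and algebraicity does not change between [B] and the union. *)
Lemma minimal_down A B (E : set (tspace n A)) (D : set (tspace n B)) : small A ->
  small B -> definable D -> same_set E D ->
  minimal (set_over (@subsetUl _ A B) E) -> minimal D.
Proof.
move=> sA sB dD ED [_ nE sep]; set U := A `|` B in sep nE *.
have sU : small U by exact: small_setU.
have BU : B `<=` U := @subsetUr _ A B.
have clD : closed D by have [] := dD.
have EDc c : E (tp A c) <-> D (tp B c).
  by have /seteqP[h1 h2] := ED; split=> h; [have [] := h1 c|have [] := h2 c].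
have DE : set_over BU D = set_over (@subsetUl _ A B) E.
  apply/seteqP; split=> q; have [c ->] := tspace_inh q; rewrite /set_over /= !restr_tp => /EDc //.
split=> // [aD|F G zF zG FD GD FG].
  by apply: nE; rewrite -DE; apply/algebraic_over.
have zU (Z : set (tspace n B)) : zeroset Z -> zeroset (set_over BU Z).
  move=> [f cf ->]; exists (f \o restr BU) => //.
  by move=> q; exact: (continuous_comp (@restr_continuous R L C n B U BU q) (cf _)).
have [|||||h|h] := sep (set_over BU F) (set_over BU G).
- exact: zU.
- exact: zU.
- by rewrite -DE => q /FD.
- by rewrite -DE => q /GD.
- by apply/seteqP; split=> // q [Fq Gq]; have : (F `&` G) (restr BU q) by []; rewrite FG.
- by left; exact: (@algebraic_over _ _ _ _ B U BU F sU (zeroset_closed zF)).1 h.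
- by right; exact: (@algebraic_over _ _ _ _ B U BU G sU (zeroset_closed zG)).1 h.
Qed.

End ApproxMinimal.

(** * Pre-minimal types *)

Section PreMinimal.
Context (R : realType) (L : language) (C : monster R L) (n : nat).
Variables (A : set C) (sA : small A).

Definition nonalg (e : R) : set (tspace n A) := [set q | ~ lt_algebraic e q].

Lemma nonalg_closed e : closed (nonalg e).
Proof. by apply: open_closedC; exact: lt_algebraic_open. Qed.

Lemma nonalg_le e e' : e <= e' -> nonalg e' `<=` nonalg e.
Proof. by move=> ee' q nq /(lt_algebraic_le sA ee'). Qed.

Lemma nonalg_bounded (b e : R) : (forall a c : 'rV[C]_n, tdist a c < b) -> b <= e ->
  nonalg e = set0.
Proof.
move=> hb be; apply/seteqP; split=> // q; have [c ->] := tspace_inh q; apply.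
apply/lt_algebraicP => // M [_ [[x Mx] _ _ _]] _ c' _.
exists (const_mx x); first by move=> i; rewrite mxE.
exact: lt_le_trans be.
Qed.

Lemma level_closed (T : topologicalType) (f : T -> R) r : continuous f ->
  closed [set q | f q <= r] /\ closed [set q | r <= f q].
Proof.
move=> cf; split.
  by apply: (@closed_comp _ _ f [set x | x <= r]) => [q _|]; [exact: cf|exact: closed_le].
by apply: (@closed_comp _ _ f [set x | r <= x]) => [q _|]; [exact: cf|exact: closed_ge].
Qed.

Lemma level_open (T : topologicalType) (f : T -> R) r : continuous f ->
  open [set q | f q < r] /\ open [set q | r < f q].
Proof.
move=> cf; split.
  by apply: (@open_comp _ _ f [set x | x < r]) => [q _|]; [exact: cf|exact: open_lt].
by apply: (@open_comp _ _ f [set x | r < x]) => [q _|]; [exact: cf|exact: open_gt].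
Qed.

Hypothesis dict : dictionaric n A.

(** The closed set [G] expresses that [p] is isolated in [D] intersected with [nonalg e], in a form
    ready for Urysohn functions. *)
Lemma pre_minimal_definable (p : tspace n A) : pre_minimal p ->
  exists D, [/\ definable D, D p, exists2 e, 0 < e & nonalg e p &
    forall e, 0 < e -> exists G : set (tspace n A), [/\ closed G, ~ G p &
      forall q, D q -> nonalg e q -> q <> p -> G q]].
Proof.
move=> [e0 /= e00 pm].
(* The hypothesis holds strictly below [e0]; halving places already [eps 0] in that range. *)
pose e1 := e0 / 2; have e10 : 0 < e1 by rewrite divr_gt0.
pose eps k : R := e1 / 2 ^+ k.
have eps0 k : 0 < eps k by rewrite divr_gt0// exprn_gt0.
have epsle a b : (a <= b)%N -> eps b <= eps a.
  by move=> ab; rewrite ler_pM2l// lef_pV2 ?posrE ?exprn_gt0// ler_eXn2l// ltr1n.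
have epsS k : eps k = 2 * eps k.+1.
  by rewrite /eps exprS invfM mulrCA mulVKf ?pnatr_eq0.
have dat k : d_atomic_in (nonalg (eps k)) p.
  apply: pm => //=; rewrite sub0r normrN gtr0_norm//.
  apply: le_lt_trans (epsle 0%N k (leq0n k)) _.
  by rewrite /eps expr0 divr1 /e1 ltr_pdivrMr// ltr_pMr// ltr1n.
have pQ k : nonalg (eps k) p by have [] := dat k.
have /choice[U UP] : forall k, exists U : set (tspace n A), [/\ open U, U p &
    U `&` nonalg (eps k) `<=` thicken [set p] (eps k)].
  move=> k; have [_ [_ _ /(_ _ (eps0 k))[U [oU pU Us]]]] := dat k.
  by exists U; split=> //; have [] := pU p erefl.
have /choice[h hP] : forall k, exists h : tspace n A -> R, [/\ continuous h,
    forall q, 0 <= h q <= 1, forall q, [set p] q -> h q = 0 & forall q, (~` U k) q -> h q = 1].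
  move=> k; have [oU Up _] := UP k; apply: urysohn => //; first exact: type_closed.
    exact: open_closedC.
  by apply/seteqP; split=> // q [/= -> /(_ Up)].
(* The doubled weight makes [f < 2 * eps k] force membership in [U k], leaving room between the
   level [eps k] to be covered and the level [2 * eps k] to be avoided. *)
have e120 : 0 < 2 * e1 by rewrite mulr_gt0.
have [||f [cf f0 fge f00]] := @sup_continuous _ _ h _ e120.
- by move=> k; have [] := hP k.
- by move=> k; have [] := hP k.
have fU k q : f q < 2 * eps k -> U k q.
  move=> fq; apply: contrapT => nU; have [_ _ _ /(_ q nU) h1] := hP k.
  by have := fge k q; rewrite h1 mulr1 -mulrA leNgt fq.
have fp : f p = 0 by apply: f00 => k; have [_ _ + _] := hP k; apply.
pose W k := thicken [set q | f q < eps k.+1] (eps k).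
(* [D_ k] covers the types at level [eps k] from which no step of length [eps k] halves the level.
   Avoiding [nonalg (eps k)] keeps [p] out; staying below [2 * eps k] makes the sets [D_ k]
   accumulate only where [f] vanishes. *)
have /choice[D_ DP] : forall k, exists D : set (tspace n A), [/\ definable D,
    [set q | f q <= eps k] `&` ~` W k `<=` D &
    D `&` (nonalg (eps k) `|` [set q | 2 * eps k <= f q]) = set0].
  move=> k; apply: dictionaric_cover => //.
  - apply: closedI; first by have [] := level_closed (eps k) cf.
    by apply: open_closedC; apply: thicken_open => //; have [] := level_open (eps k.+1) cf.
  - apply: closedU; first exact: nonalg_closed.
    by have [_] := level_closed (2 * eps k) cf.
  apply/seteqP; split=> // q [[/= fq nW] [nq|/= fq2]]; last first.
    by have := eps0 k; move: fq fq2; lra.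
  apply: nW; have [_ _ Us] := UP k.
  have Uq : U k q by apply: fU; have := eps0 k; move: fq; lra.
  have := Us q (conj Uq nq); rewrite /W; have [c ->] := tspace_inh q.
  move=> /(thickenP _ _ _ sA)[b bp cb]; apply/thickenP => //; exists b => //=.
  by rewrite bp fp.
pose fin N := [set q | exists2 k, (k < N)%N & D_ k q].
have dfin N : definable (fin N).
  elim: N => [|N ih].
    by rewrite (_ : fin 0%N = set0); [exact: definable0|apply/seteqP; split=> // q []].
  rewrite (_ : fin N.+1 = fin N `|` D_ N).
    by apply: definableU => //; have [] := DP N.
  apply/seteqP; split=> q.
    by move=> [k]; rewrite ltnS leq_eqVlt => /orP[/eqP -> ?|kN ?]; [right|left; exists k].
  by move=> [[k kN Dq]|Dq]; [exists k; rewrite // ltnW|exists N].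
have Dnot k q : D_ k q -> ~ nonalg (eps k) q /\ f q < 2 * eps k.
  move=> Dq; have [_ _ /seteqP[DF _]] := DP k; split=> [nq|].
    by apply: (DF q); split=> //; left.
  by rewrite ltNge; apply/negP => fq; apply: (DF q); split=> //; right.
pose D := [set q | f q = 0] `|` [set q | exists k, D_ k q].
have finD N : fin N `<=` D by move=> q [k _ Dq]; right; exists k.
have Dfin k q : D q -> f q < eps k \/ fin k.+1 q.
  move=> [/= ->|[j Dj]]; first by left.
  have [jk|kj] := ltnP j k.+1; first by right; exists j.
  left; have [_ fq] := Dnot _ _ Dj; apply: lt_le_trans fq _.
  by rewrite (epsS k) ler_pM2l// epsle.
have clD : closed D.
  move=> q Dq; have [fq|fq] := eqVneq (f q) 0; first by left.
  have r0 : 0 < f q by rewrite lt_neqAle eq_sym fq f0.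
  have [N hN] := half_lt e1 r0.
  apply: (finD N.+1); have [clf _ _] := dfin N.+1; apply: clf => V nV.
  have nf : nbhs q [set q' | eps N < f q'].
    by apply: open_nbhs_nbhs; split=> //; have [] := level_open (eps N) cf.
  have [q' [Dq' [Vq' /= fq']]] := Dq _ (filterI nV nf); exists q'; split=> //.
  by have [|//] := Dfin N q' Dq'; rewrite ltNge (ltW fq').
have near_D k c : f (tp A c) <= eps k -> exists2 b, D (tp A b) & tdist c b <= 2 * eps k.
  (* The walk rests once it is in [D]; otherwise its point is in [W (k + j)], which supplies the
     next step. The lengths [eps (k + j)] sum to [2 * eps k]. *)
  move=> fc; pose Inv j : set 'rV[C]_n := [set b | D (tp A b) \/ f (tp A b) <= eps (k + j)%N].
  have [||x [l [x0 xI xl]]] := @tdist_limit R L C n Inv (2 * eps k) c.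
  - by right; rewrite addn0.
  - move=> j b Ib; have [Db|nDb] := pselect (D (tp A b)).
      by exists b; [left|rewrite tdistxx divr_ge0 ?exprn_ge0// mulr_ge0// ltW].
    case: Ib => // fb; have Wb : W (k + j)%N (tp A b).
      apply: contrapT => nW; apply: nDb; right; exists (k + j)%N.
      by have [_ + _] := DP (k + j)%N; apply; split.
    have /(thickenP _ _ _ sA)[b' /= fb' bb'] := Wb.
    exists b'; first by right; rewrite addnS ltW.
    have <- : eps (k + j)%N = 2 * eps k / 2 ^+ j.+1.
      by rewrite /eps exprD exprS; field; rewrite !expf_neq0.
    exact: ltW.
  exists l; last by have := xl 0%N; rewrite x0 expr0 divr1.
  (* If the limit were outside [D], then by closedness late points of the walk would be outside too,
     so [f] would tend to 0 along them; but types where [f] vanishes are in [D]. *)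
  apply: contrapT => nDl.
  have [d d0 hd] : exists2 d, 0 < d & forall b, tdist l b < d -> ~ D (tp A b).
    apply: contrapT => hn; apply: nDl; apply: closed_metric => // d d0.
    apply: contrapT => hb; apply: hn; exists d => // b lb Db; apply: hb; by exists b.
  apply: nDl; left; apply/eqP; rewrite eq_le f0 andbT; apply/ler_addgt0Pl => eta eta0.
  have eta20 : 0 < eta / 2 by rewrite divr_gt0.
  have [d' d'0 hd'] := continuous_metric sA cf eta20.
  have m0 : 0 < Order.min (Order.min d d') (eta / 2) by rewrite !lt_min d0 d'0.
  have [j hj] := half_lt (2 * eps k) m0; rewrite !lt_min in hj.
  have /andP[/andP[h1 h2] h3] := hj.
  have lx := xl j; rewrite tdistC in lx.
  have [Dx|fx] := xI j; first by exfalso; exact: hd (le_lt_trans lx h1) Dx.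
  have e3 : eps (k + j)%N <= 2 * eps k / 2 ^+ j.
    rewrite /eps exprD invfM mulrA ler_pM2r ?invr_gt0 ?exprn_gt0//.
    by rewrite ler_peMl ?ler1n// ltW// eps0.
  have := hd' _ _ (le_lt_trans lx h2); rewrite ltr_norml => /andP[h4 h5].
  by move: fx e3 h3 h4 h5; rewrite addr0; lra.
exists D; split.
- split=> // e e0'.
  have [k hk] := half_lt (3 * e1) e0'; rewrite -mulrA -/(eps k) in hk.
  have [_ _ /(_ e e0')[V [oV FV Vs]]] := dfin k.+1.
  exists ([set q | f q < eps k] `|` V); split.
  + by apply: openU => //; have [] := level_open (eps k) cf.
  + by move=> q /(Dfin k)[?|/FV[? _]]; split=> //; [left|right].
  + move=> q; have [c ->] := tspace_inh q => -[[/= fc|Vc] _]; apply/thickenP => //.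
      have [b Db cb] := near_D k c (ltW fc); exists b => //.
      by have := eps0 k; move: cb hk; lra.
    have /Vs/(thickenP _ _ _ sA)[b /finD Db cb] : (V `&` setT) (tp A c) by [].
    by exists b.
- by left.
- by exists (eps 0%N).
(* From [N] on, [D_ k] avoids [nonalg e], so only finitely many pieces contribute. A type of
   [nonalg e] where [f] vanishes lies in [U k] for all [k], hence at distance 0 from [p]. *)
- move=> e e0'; have [N hN] := half_lt e1 e0'; rewrite -/(eps N) in hN.
  exists (nonalg e `&` fin N); split.
  + by apply: closedI; [exact: nonalg_closed|have [] := dfin N].
  + by move=> [_ [k _ /Dnot[]]]; have := pQ k.
  + move=> q Dq nq qp; split=> //.
    case: Dq => [/= fq|[k Dk]]; last first.
      exists k => //; rewrite ltnNge; apply/negP => Nk.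
      have [+ _] := Dnot _ _ Dk; apply; apply: nonalg_le nq.
      exact: le_trans (epsle _ _ Nk) (ltW hN).
    exfalso; apply: qp; have [c qE] := tspace_inh q.
    suff : [set p] (tp A c) by rewrite qE.
    apply: closed_metric; first exact: type_closed.
    move=> d d0; have [j hj] := half_lt e1 d0; rewrite -/(eps j) in hj.
    pose k := maxn N j.
    have [_ _ /(_ q) Us] := UP k.
    have /Us : (U k `&` nonalg (eps k)) q.
      split; first by apply: fU; rewrite fq mulr_gt0.
      by apply: nonalg_le nq; apply: le_trans (ltW hN); exact: epsle (leq_maxl _ _).
    rewrite qE => /(thickenP _ _ _ sA)[b bp cb]; exists b => //.
    apply: lt_trans hj; apply: lt_le_trans cb _; exact: epsle (leq_maxr _ _).
Qed.

Lemma pre_minimal_approx (p : tspace n A) : pre_minimal p ->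
  exists (D : set (tspace n A)) (P : tspace n A -> R),
    approx_minimal D P /\ pair_points_to D P p.
Proof.
move=> /pre_minimal_definable[D [dD Dp [e1 e10 np] DG]].
have [b b0 hb] := tdist_bounded C n.
(* Starting from a bound [b] of all distances, every radius below [b] lies in some dyadic interval;
   for radii at least [b] every type is algebraic. *)
pose c k : R := b / 2 ^+ k.
have c0 k : 0 < c k by rewrite divr_gt0// exprn_gt0.
(* The shift to [c k.+1] is for radii [e] between [c k.+1] and [c k]: a type of [nonalg e] is in
   [nonalg (c k.+1)], so [G k] catches it. *)
have /choice[G GP] := fun k => DG (c k.+1) (c0 k.+1).
have /choice[g gP] : forall k, exists g : tspace n A -> R, [/\ continuous g,
    forall q, 0 <= g q <= 1, forall q, [set p] q -> g q = 0 & forall q, G k q -> g q = 1].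
  move=> k; have [clG nGp _] := GP k; apply: urysohn => //; first exact: type_closed.
  by apply/seteqP; split=> // q [/= -> /nGp].
(* With weight [2 * b], the function is at least [2 * c k] on [G k], which exceeds each radius
   [e <= c k]. *)
have b20 : 0 < 2 * b by rewrite mulr_gt0.
have [||P1 [cP1 P10 P1ge P100]] := @sup_continuous _ _ g _ b20.
- by move=> k; have [] := gP k.
- by move=> k; have [] := gP k.
have [fD cfD DE] := definable_zeroset sA dD.
pose P q := `|fD q| + P1 q.
have P1p : P1 p = 0 by apply: P100 => k; have [_ _ + _] := gP k; apply.
have Zp : P p = 0.
  by rewrite /P P1p addr0; move: Dp; rewrite DE /zeros /= => ->; rewrite normr0.
have ZD : zeros P `<=` D.
  move=> q /eqP; rewrite paddr_eq0// => /andP[+ _].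
  by rewrite normr_eq0 => /eqP fq; rewrite DE.
have cP : continuous P by move=> q; exact: (cvgD (cvg_norm (cfD q)) (cP1 q)).
have key q e : D q -> q <> p -> 0 < e -> P q <= e -> lt_algebraic e q.
  move=> Dq qp e0 Pq; apply: contrapT => nq.
  have [be|eb] := leP b e.
    by have : nonalg e q by []; rewrite (nonalg_bounded hb be).
  have [|j _ /andP[h1 h2]] := @dyadic R b e 0%N b0 e0; first by rewrite expr0 divr1 ltW.
  have [_ _ /(_ q Dq) Gq] := GP j; have [_ _ _ /(_ q) g1] := gP j.
  have := P1ge j q; rewrite g1; last by apply: Gq => //; exact: nonalg_le nq.
  have := normr_ge0 (fD q); move: Pq h2; rewrite /P mulr1 -mulrA => h3 h4 h5 h6.
  move: h3 h4 h5 h6 e0; move: (b / 2 ^+ j) => y; lra.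
have npp : ~ algebraic [set p].
  by move=> ap; apply: np; exact: algebraic_lt_algebraic.
exists D, P; split; split=> //.
- move=> aZ; apply: npp; apply: (@algebraic_subset R L C n A [set p] (zeros P)) => //.
    exact: type_closed.
  by move=> q ->.
- move=> F G' _ _ FD GD FG M _ _ e e0.
  have [Fp|nFp] := pselect (F p); last first.
    left => q [Fq /= Pq]; apply: key => //; first exact: FD.
    by move=> qp; apply: nFp; rewrite -qp.
  right => q [Gq /= Pq]; apply: key => //; first exact: GD.
  move=> qp; rewrite qp in Gq; have : (F `&` G') p by []; by rewrite FG.
- move=> q Zq nq; apply: contrapT => qp; apply: nq.
  apply: lt_algebraic_algebraic => //; first exact: type_closed.
  by move=> e e0 r ->; apply: key => //; [exact: ZD|rewrite Zq ltW].
Qed.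

End PreMinimal.

Theorem proposition5p15 (R : realType) (L : language) (C : monster R L)
    (n : nat) (A : set C) (smallA : small A) :
  (dictionaric n A -> forall p : tspace n A, pre_minimal p ->
    exists (D : set (tspace n A)) (P : tspace n A -> R),
      approx_minimal D P /\ pair_points_to D P p)
  /\
  (forall (D : set (tspace n A)) (P : tspace n A -> R)
      (M : set C) (AM : A `<=` M),
    model M -> definable D -> continuous P ->
    approx_minimal (set_over AM D) (formula_over AM P) ->
    exists E : set (tspace n (params D M)),
      [/\ definable E,
          realizations E setT `<=` realizations D setT,
          minimal (set_over (params_sub AM) E) &
          exists p : tspace n M,
            pair_points_to (set_over AM D) (formula_over AM P) p /\
            set_points_to (set_over (params_sub AM) E) p])
  /\
  (forall (D : set (tspace n A)) (P : tspace n A -> R),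
    approx_strongly_minimal D P ->
    forall M : set C, model M -> A `<=` M ->
    exists E : set (tspace n (params D M)),
      [/\ definable E,
          realizations E setT `<=` realizations D setT,
          strongly_minimal E,
          (forall (B : set C) (AB : A `<=` B) (EB : params D M `<=` B),
            small B ->
            exists p : tspace n B,
              pair_points_to (set_over AB D) (formula_over AB P) p /\
              set_points_to (set_over EB E) p) &
          forall N : set C, model N -> M `<=` N ->
            realizations E N `\` [set a | P (tp A a) = 0]
              `<=` realizations D M]).

Proof.
split; first by move=> dict p; exact: pre_minimal_approx.
split.
  move=> D P M AM mM dD cP am; have [E [dE DE ZE EZ]] := minimal_core mM dD cP am.
  exists E; have [mE pE] :=
    @minimal_over R L C n A D P M E M AM (params_sub AM) mM.1 cP dE am ZE EZ.
  by split=> // c [_ /DE Dc]; split.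
move=> D P asm M mM AM; have [dD cP _] := asm.
have am := @approx_strongly_over R L C n A M AM D P mM.1 asm.
have [E [dE DE ZE EZ]] := minimal_core mM dD cP am.
have sB : small (params D M) := small_sub (@params_sub R L C n A D M AM) mM.1.
have over (B : set C) (AB : A `<=` B) (EB : params D M `<=` B) (sB' : small B) :=
  @minimal_over R L C n A D P M E B AB EB sB' cP dE
    (@approx_strongly_over R L C n A B AB D P sB' asm) ZE EZ.
exists E; split=> //.
- by move=> c [_ /DE Dc]; split.
- split=> // B D' sB' dD' ED'.
  apply: (minimal_down sB sB' dD' ED').
  (* [B] need not contain the parameters of [E]; minimality is obtained over the union and descends
     to [B]. *)
  have AU : A `<=` params D M `|` B by move=> x Ax; left; right.
  by have [] := over _ AU (@subsetUl _ _ B) (small_setU sB sB').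
- by move=> B AB EB sB'; have [] := over B AB EB sB'.
- by move=> N _ _ c [[_ Ec] Pc]; exact: EZ.
Qed.
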